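(* Let $n,k$ be positive integers, let $\mathfrak{g}=\mathfrak{gl}_n$, and let $V=\bigwedge\mathbb{C}^n$ be the exterior algebra of the natural representation $V(\Lambda_1)=\mathbb{C}^n$. Let $\lambda=(\lambda_1\ge\cdots\ge\lambda_n\ge0)$ be a partition with at most $n$ parts. Then the multiplicity of the irreducible representation $V(\lambda)$ in $V^{\otimes k}$ is $$\det\left[\binom{k+i}{k+i-j-\lambda_{n-j}}\right]_{i,j=0}^{n-1}=\det\left[\binom{k+i}{j+\lambda_{n-j}}\right]_{i,j=0}^{n-1}.$$
   Context: $V(\lambda)$ is the irreducible $\mathfrak{gl}_n$-representation with highest weight $\lambda$. Binomial coefficients $\binom{a}{b}$ with $a\ge0$ are zero when $b<0$ or $b>a$. *)

(* Defs.v *)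
From HB Require Import structures.
From mathcomp Require Import all_boot all_order all_algebra.
From mathcomp Require Import boolp reals complex.

Set Implicit Arguments.
Unset Strict Implicit.
Unset Printing Implicit Defensive.

Import Order.TTheory GRing.Theory Num.Theory.
Local Open Scope ring_scope.

(** * Finite-dimensional representations of gl_n *)

Section Representations.
Variables (F : fieldType) (n : nat).

Record glrep := GLRep {
  glcar :> vectType F;
  glact : 'M[F]_n -> 'End(glcar);
  glact_linear : linear glact;
  glact_bracket : forall A B : 'M[F]_n,
    glact (A *m B - B *m A)
    = ((glact A \o glact B) - (glact B \o glact A))%VF }.

Definition stable (M : glrep) (U : {vspace M}) : Prop :=
  forall A : 'M[F]_n, (glact M A @: U <= U)%VS.

Definition irreducible_sub (M : glrep) (U : {vspace M}) : Prop :=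
  [/\ stable U, U <> 0%VS &
      forall W : {vspace M}, (W <= U)%VS -> stable W -> W = 0%VS \/ W = U].

Definition irreducible (M : glrep) : Prop := irreducible_sub (fullv : {vspace M}).

Definition equivariant (L M : glrep) (f : 'Hom(L, M)) : Prop :=
  forall A : 'M[F]_n, (f \o glact L A = glact M A \o f)%VF.

(* The subrepresentation U of M is isomorphic to L. *)
Definition sub_iso (L M : glrep) (U : {vspace M}) : Prop :=
  exists f : 'Hom(L, M), [/\ equivariant f, lker f = 0%VS & limg f = U].

Definition irreducible_decomposition (M : glrep) (r : nat)
    (U : 'I_r -> {vspace M}) : Prop :=
  [/\ forall s, irreducible_sub (U s),
      directv (\sum_(s < r) U s)%VS &
      (\sum_(s < r) U s)%VS = fullv].

(* m is the multiplicity of L in M: M is a direct sum of irreducible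
   subrepresentations, and every such decomposition of M has exactly m summands
   isomorphic to L. *)
Definition has_multiplicity (L M : glrep) (m : nat) : Prop :=
  (exists r : nat, exists U : 'I_r -> {vspace M}, irreducible_decomposition U)
  /\ forall (r : nat) (U : 'I_r -> {vspace M}), irreducible_decomposition U ->
       #|[set s | `[< sub_iso L (U s) >]]| = m.

(* Highest weight vectors for the upper triangular Borel subalgebra; the weight
   la is that of the diagonal matrices, diag(a_1, .., a_n) |-> sum a_i la_i. *)
Definition highest_weight_vector (M : glrep) (la : 'I_n -> nat) (v : M) : Prop :=
  [/\ v <> 0,
      forall i j : 'I_n, (i < j)%N -> glact M (delta_mx i j) v = 0 &
      forall i : 'I_n, glact M (delta_mx i i) v = (la i)%:R *: v].

(* L is a model of V(la), which is unique up to isomorphism. *)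
Definition is_irrep_of_highest_weight (L : glrep) (la : 'I_n -> nat) : Prop :=
  irreducible L /\ exists v : L, highest_weight_vector la v.

(** ** Trivial representation, tensor products and tensor powers *)

(* F as a vector space over itself; packaging it as a vectType keeps canonical
   structure inference fast in the Hom spaces below. *)
Definition line : vectType F := F^o.

Definition trivial_act (A : 'M[F]_n) : 'End(line) := 0.

Fact trivial_linear : linear trivial_act.
Proof. by move=> a A B; rewrite /trivial_act scaler0 addr0. Qed.

Fact trivial_bracket (A B : 'M[F]_n) :
  trivial_act (A *m B - B *m A)
  = ((trivial_act A \o trivial_act B) - (trivial_act B \o trivial_act A))%VF.
Proof. by rewrite /trivial_act subrr. Qed.

Definition trivial_rep : glrep := GLRep trivial_linear trivial_bracket.

Fact addr_cross (Z : zmodType) (a b c d p q : Z) :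
  a - b + (c - d) = a + p + (q + c) - (b + q + (p + d)).
Proof.
rewrite [a + p + _](AC (2*2) ((2*3)*(1*4))) [b + q + _](AC (2*2) ((3*2)*(1*4))).
by apply/esym; rewrite opprD addrACA subrr add0r opprD addrACA.
Qed.

Fact sub_lfunE (U U' : vectType F) (f g : 'Hom(U, U')) x :
  (f - g) x = f x - g x.
Proof. by rewrite add_lfunE opp_lfunE. Qed.

Fact lfun_commP (U : vectType F) (h f g : 'End(U)) :
  (forall x, h x = f (g x) - g (f x)) -> h = ((f \o g) - (g \o f))%VF.
Proof. by move=> hE; apply/lfunP => x; rewrite sub_lfunE !comp_lfunE. Qed.

Fact subr_cancel (Z : zmodType) (a b c : Z) : a - c - (b - c) = a - b.
Proof. by rewrite opprB addrA subrK. Qed.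

Section Tensor.
Variables V W : glrep.

(* V (x) W is realized as Hom(V^*, W), in which v (x) w is phi |-> phi(v) w. *)
Local Notation tensor := 'Hom('Hom(V, line), W).

Definition pure_tensor (v : V) (w : W) : tensor :=
  linfun (fun phi : 'Hom(V, line) => (phi v : F) *: w).

Definition tensor_act_fun (A : 'M[F]_n) (X : tensor) : tensor :=
  linfun (fun phi : 'Hom(V, line) =>
            X (phi \o glact V A)%VF + glact W A (X phi)).

Definition tensor_act (A : 'M[F]_n) : 'End(tensor) := linfun (tensor_act_fun A).

Lemma pure_tensorE v w phi : pure_tensor v w phi = (phi v : F) *: w.
Proof.
pose g (psi : 'Hom(V, line)) : W := (psi v : F) *: w.
have g_lin : linear g.
  by move=> a p q; rewrite /g add_lfunE scale_lfunE scalerDl scalerA.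
pose gL := HB.pack_for {linear 'Hom(V, line) -> W} g
  (GRing.isLinear.Build _ _ _ _ g g_lin).
exact: (lfunE gL).
Qed.

Lemma tensor_act_funE A X phi :
  tensor_act_fun A X phi = X (phi \o glact V A)%VF + glact W A (X phi).
Proof.
pose g (psi : 'Hom(V, line)) : W :=
  X (psi \o glact V A)%VF + glact W A (X psi).
have g_lin : linear g.
  move=> a p q; rewrite /g comp_lfunDl -comp_lfunZl !linearP /=.
  by rewrite scalerDr addrACA.
pose gL := HB.pack_for {linear 'Hom(V, line) -> W} g
  (GRing.isLinear.Build _ _ _ _ g g_lin).
exact: (lfunE gL).
Qed.

Lemma tensor_actE A X phi :
  tensor_act A X phi = X (phi \o glact V A)%VF + glact W A (X phi).
Proof.
have g_lin : linear (tensor_act_fun A).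
  move=> a Y Z; apply/lfunP => psi.
  rewrite !(tensor_act_funE, add_lfunE, scale_lfunE) linearP /=.
  by rewrite scalerDr addrACA.
pose gL := HB.pack_for {linear tensor -> tensor} (tensor_act_fun A)
  (GRing.isLinear.Build _ _ _ _ _ g_lin).
by rewrite (lfunE gL) /= tensor_act_funE.
Qed.

Lemma tensor_act_pure A v w :
  tensor_act A (pure_tensor v w)
  = pure_tensor (glact V A v) w + pure_tensor v (glact W A w).
Proof.
apply/lfunP => phi.
by rewrite tensor_actE add_lfunE !pure_tensorE comp_lfunE linearZ.
Qed.

Fact tensor_linear : linear tensor_act.
Proof.
move=> a A B; apply/lfunP => X; apply/lfunP => phi.
rewrite !(tensor_actE, add_lfunE, scale_lfunE) !glact_linear.
rewrite comp_lfunDr -comp_lfunZr !(linearP, add_lfunE, scale_lfunE) /=.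
by rewrite scalerDr addrACA.
Qed.

Fact tensor_bracket (A B : 'M[F]_n) :
  tensor_act (A *m B - B *m A)
  = ((tensor_act A \o tensor_act B) - (tensor_act B \o tensor_act A))%VF.
Proof.
apply: lfun_commP => X; apply/lfunP => phi.
have E (P Q : 'M[F]_n) : tensor_act P (tensor_act Q X) phi =
    X ((phi \o glact V P) \o glact V Q)%VF + glact W Q (X (phi \o glact V P)%VF)
    + (glact W P (X (phi \o glact V Q)%VF) + glact W P (glact W Q (X phi))).
  by rewrite tensor_actE (tensor_actE Q X) (tensor_actE Q X phi) linearD.
have XE : X (phi \o glact V (A *m B - B *m A))%VF
    = X ((phi \o glact V A) \o glact V B)%VF - X ((phi \o glact V B) \o glact V A)%VF.
  by rewrite glact_bracket comp_lfunDr comp_lfunNr !comp_lfunA linearB.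
have WE : glact W (A *m B - B *m A) (X phi)
    = glact W A (glact W B (X phi)) - glact W B (glact W A (X phi)).
  by rewrite glact_bracket sub_lfunE !comp_lfunE.
rewrite (tensor_actE _ X phi) XE WE (sub_lfunE (tensor_act A _)) (E A B) (E B A).
exact: addr_cross.
Qed.

Definition tensor_rep : glrep := GLRep tensor_linear tensor_bracket.

End Tensor.

Definition tensor_power (V : glrep) (k : nat) : glrep :=
  iter k (tensor_rep V) trivial_rep.

End Representations.

(** * The exterior algebra of F^n *)

Section Exterior.
Variables (F : fieldType) (n : nat).

(* x S is the coordinate of x on e_S = e_(s_1) /\ .. /\ e_(s_m), where
   S = {s_1 < .. < s_m}. *)
Local Notation ext := {ffun {set 'I_n} -> F^o}.

Definition ext_basis (S : {set 'I_n}) : ext := [ffun T => (T == S)%:R].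

Definition inversions (S T : {set 'I_n}) : nat :=
  #|[set p in setX S T | (p.2 < p.1)%N]|.

Definition wedge (x y : ext) : ext :=
  \sum_(S : {set 'I_n}) \sum_(T : {set 'I_n} | [disjoint S & T])
     (x S * y T * (-1) ^+ inversions S T) *: ext_basis (S :|: T).

Definition ext_vec (v : 'cV[F]_n) : ext :=
  \sum_(i < n) v i 0 *: ext_basis [set i].

(* The derivation extending the natural action on C^n :
   A e_S = \sum_r e_(s_1) /\ .. /\ A e_(s_r) /\ .. /\ e_(s_m). *)
Definition ext_act_basis (A : 'M[F]_n) (S : {set 'I_n}) : ext :=
  \sum_(s in S)
     wedge (wedge (ext_basis [set t in S | (t < s)%N]) (ext_vec (col s A)))
           (ext_basis [set t in S | (s < t)%N]).

Definition ext_act_fun (A : 'M[F]_n) (x : ext) : ext :=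
  \sum_(S : {set 'I_n}) x S *: ext_act_basis A S.

Definition ext_act (A : 'M[F]_n) : 'End(ext) := linfun (ext_act_fun A).

Lemma ext_actE A x : ext_act A x = ext_act_fun A x.
Proof.
have g_lin : linear (ext_act_fun A).
  move=> a y z; rewrite /ext_act_fun scaler_sumr -big_split /=.
  by apply: eq_bigr => S _; rewrite !ffunE scalerDl scalerA.
pose gL := HB.pack_for {linear ext -> ext} (ext_act_fun A)
  (GRing.isLinear.Build _ _ _ _ _ g_lin).
exact: (lfunE gL).
Qed.

Lemma wedge_basis S T :
  wedge (ext_basis S) (ext_basis T) =
  if [disjoint S & T] then (-1) ^+ inversions S T *: ext_basis (S :|: T) else 0.
Proof.
rewrite /wedge (bigD1 S) //= [X in _ + X]big1 ?addr0; last first.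
  move=> S' neS; rewrite big1 // => T' _.
  by rewrite ffunE (negPf neS) !mul0r scale0r.
rewrite big_mkcond (bigD1 T) //= [X in _ + X]big1 ?addr0; last first.
  move=> T' neT; case: ifP => // _.
  by rewrite !ffunE (negPf neT) mulr0 mul0r scale0r.
by rewrite !ffunE !eqxx !mul1r.
Qed.

Lemma wedge_linear_l y : linear (wedge^~ y).
Proof.
move=> a x x'; rewrite /wedge scaler_sumr -big_split; apply: eq_bigr => S _ /=.
rewrite scaler_sumr -big_split; apply: eq_bigr => T _ /=.
by rewrite !ffunE scalerA -scalerDl !mulrDl !mulrA.
Qed.

Lemma wedge_linear_r x : linear (wedge x).
Proof.
move=> a y y'; rewrite /wedge scaler_sumr -big_split; apply: eq_bigr => S _ /=.
rewrite scaler_sumr -big_split; apply: eq_bigr => T _ /=.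
rewrite !ffunE scalerA -scalerDl; congr (_ *: _).
by rewrite mulrDr mulrDl; congr (_ + _); rewrite !mulrA (mulrC (x S)).
Qed.

(* Creation and annihilation operators: e_i /\ - and contraction by e_j^*.
   They are only used to prove that ext_act respects brackets. *)
Definition ksign (i : 'I_n) (T : {set 'I_n}) : F :=
  (-1) ^+ #|[set t in T | (t < i)%N]|.

Definition cr_fun (i : 'I_n) (x : ext) : ext :=
  [ffun T : {set 'I_n} => if i \in T then ksign i T * x (T :\ i) else 0].

Definition an_fun (j : 'I_n) (x : ext) : ext :=
  [ffun T : {set 'I_n} => if j \in T then 0 else ksign j T * x (j |: T)].

Definition cr i : 'End(ext) := linfun (cr_fun i).
Definition an j : 'End(ext) := linfun (an_fun j).

Lemma crE i x T :
  cr i x T = if i \in T then ksign i T * x (T :\ i) else 0.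
Proof.
have g_lin : linear (cr_fun i).
  move=> a y z; apply/ffunP => S; rewrite !ffunE.
  case: ifP => _; last by rewrite scaler0 addr0.
  by rewrite mulrDr; congr (_ + _); exact: mulrCA.
pose gL := HB.pack_for {linear ext -> ext} (cr_fun i)
  (GRing.isLinear.Build _ _ _ _ _ g_lin).
by rewrite (lfunE gL) ffunE.
Qed.

Lemma anE j x T :
  an j x T = if j \in T then 0 else ksign j T * x (j |: T).
Proof.
have g_lin : linear (an_fun j).
  move=> a y z; apply/ffunP => S; rewrite !ffunE.
  case: ifP => _; first by rewrite scaler0 addr0.
  by rewrite mulrDr; congr (_ + _); exact: mulrCA.
pose gL := HB.pack_for {linear ext -> ext} (an_fun j)
  (GRing.isLinear.Build _ _ _ _ _ g_lin).
by rewrite (lfunE gL) ffunE.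
Qed.

Lemma ksignU (i j : 'I_n) (T : {set 'I_n}) : j \notin T -> ksign i (j |: T) = (-1) ^+ (j < i)%N * ksign i T.
Proof.
move=> jT; rewrite /ksign -exprD; congr (_ ^+ _).
rewrite (cardsD1 j) !inE eqxx /=; congr (_ + _)%N.
apply: eq_card => t; rewrite !inE; case: eqP => [->|] //=.
by rewrite (negPf jT).
Qed.

Lemma ksignD (i j : 'I_n) (T : {set 'I_n}) : j \in T -> ksign i (T :\ j) = (-1) ^+ (j < i)%N * ksign i T.
Proof.
move=> jT; rewrite -{2}(setD1K jT) ksignU ?setD11 //.
by rewrite mulrA -exprD addnn -signr_odd odd_double mul1r.
Qed.

Lemma ksign_sq i T : ksign i T * ksign i T = 1.
Proof. by rewrite /ksign -exprD addnn -signr_odd odd_double. Qed.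

Lemma ltn_sign (i j : 'I_n) : i != j ->
  (-1) ^+ (j < i)%N = - (-1) ^+ (i < j)%N :> F.
Proof.
move=> ne; have : (i : nat) != j by [].
by rewrite neq_ltn; case: ltngtP => //= _ _; rewrite ?opprK.
Qed.

Lemma car_an_cr j i x :
  an j (cr i x) = (j == i)%:R *: x - cr i (an j x).
Proof.
apply/ffunP => T; rewrite !ffunE anE crE !crE anE !inE.
have [-> | ne] := eqVneq j i.
  rewrite scale1r; case: ifP => [iT|/negbT iT].
    by rewrite ksignD // ltnn mul1r setD1K // mulrA ksign_sq mul1r subrr.
  by rewrite subr0 ksignU // ltnn mul1r setU1K // mulrA ksign_sq mul1r.
rewrite scale0r sub0r /=.
case: (boolP (j \in T)) => jT; case: (boolP (i \in T)) => iT;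
  rewrite ?mulr0 ?oppr0 //=.
rewrite ksignU // ksignD // (_ : (j |: T) :\ i = j |: (T :\ i)); last first.
  by apply/setP => t; rewrite !inE; case: eqP => // ->; rewrite eq_sym (negPf ne).
rewrite (ltn_sign ne) !mulrA mulrN !mulNr opprK; congr (_ * _).
by rewrite [LHS](ACl (3*2*1)).
Qed.

Lemma car_cr_cr i j x : cr i (cr j x) = - cr j (cr i x).
Proof.
apply/ffunP => T; rewrite !ffunE !crE !inE.
have [-> | ne] := eqVneq i j.
  by rewrite ?eqxx /= mulr0; case: ifP => _; rewrite ?oppr0.
rewrite /=.
case: (boolP (j \in T)) => jT; case: (boolP (i \in T)) => iT;
  rewrite ?mulr0 ?oppr0 //=.
rewrite !ksignD // (ltn_sign ne) setDDl setUC -setDDl.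
by rewrite !(mulNr, mulrN) ?opprK; rewrite !mulrA; congr (_ * _); rewrite [LHS](ACl (3*2*1)).
Qed.

Lemma car_an_an i j x : an i (an j x) = - an j (an i x).
Proof.
apply/ffunP => T; rewrite !ffunE !anE !inE.
have [-> | ne] := eqVneq i j.
  by rewrite ?eqxx /= mulr0; case: ifP => _; rewrite ?oppr0.
rewrite /=.
case: (boolP (j \in T)) => jT; case: (boolP (i \in T)) => iT;
  rewrite ?mulr0 ?oppr0 //=.
rewrite !ksignU // (ltn_sign ne) setUCA.
by rewrite !(mulNr, mulrN) ?opprK; rewrite !mulrA; congr (_ * _); rewrite [LHS](ACl (3*2*1)).
Qed.


Lemma an_basis s S :
  an s (ext_basis S) = if s \in S then ksign s S *: ext_basis (S :\ s) else 0.
Proof.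
apply/ffunP => T; rewrite anE ffunE.
case: (boolP (s \in S)) => sS; rewrite !ffunE; case: (boolP (s \in T)) => sT //.
- by rewrite (_ : T == _ = false) ?scaler0 //; apply/eqP => eT; move: sT; rewrite eT setD11.
- have -> : (s |: T == S) = (T == S :\ s).
    by apply/eqP/eqP => [<-|->]; [rewrite setU1K | rewrite setD1K].
  by case: eqP => [->|_]; rewrite ?mulr0 ?scaler0 // ksignD // ltnn mul1r.
- by rewrite (_ : _ == _ = false) ?mulr0 //; apply/eqP => eT; move: sS; rewrite -eT setU11.
Qed.

Lemma cr_basis i S :
  cr i (ext_basis S) = if i \in S then 0 else ksign i S *: ext_basis (i |: S).
Proof.
apply/ffunP => T; rewrite crE ffunE.
case: (boolP (i \in S)) => iS; rewrite !ffunE; case: (boolP (i \in T)) => iT //.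
- by rewrite (_ : _ == _ = false) ?mulr0 //; apply/eqP => eT; move: iS; rewrite -eT setD11.
- have -> : (T :\ i == S) = (T == i |: S).
    by apply/eqP/eqP => [<-|->]; [rewrite setD1K | rewrite setU1K].
  by case: eqP => [->|_]; rewrite ?mulr0 ?scaler0 // ksignU // ltnn mul1r.
- by rewrite (_ : T == _ = false) ?scaler0 //; apply/eqP => eT; move: iT; rewrite eT setU11.
Qed.

Lemma card_signE (S : {set 'I_n}) (P : pred 'I_n) :
  (-1) ^+ #|[set t in S | P t]| = \prod_(t in S) (-1) ^+ (P t) :> F.
Proof.
rewrite -expr_sum; congr (_ ^+ _).
rewrite -sum1_card big_mkcond [RHS]big_mkcond /=; apply: eq_bigr => t _.
by rewrite inE; case: (t \in S); case: (P t).
Qed.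

Lemma wedge_replace (i s : 'I_n) (S : {set 'I_n}) : s \in S ->
  wedge (wedge (ext_basis [set t in S | (t < s)%N]) (ext_basis [set i]))
        (ext_basis [set t in S | (s < t)%N])
  = cr i (an s (ext_basis S)).
Proof.
move=> sS; rewrite an_basis sS linearZ /= cr_basis.
set L := [set t in S | (t < s)%N]; set R := [set t in S | (s < t)%N].
have wZ a (x y : ext) : wedge (a *: x) y = a *: wedge x y.
  have /= := wedge_linear_l y a x 0.
  have w0 : wedge 0 y = 0.
    by have /= := wedge_linear_l y (-1) 0 0; rewrite !scaleN1r !addNr.
  by rewrite !addr0 w0 addr0.
have w0 y : wedge 0 y = 0 by have := wZ 0 0 y; rewrite !scale0r.
have iLR : (i \in S :\ s) = (i \in L) || (i \in R).
  rewrite !inE -val_eqE; case: (i \in S); rewrite ?andbF //= !andbT.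
  by rewrite neq_ltn.
rewrite wedge_basis disjoint_sym disjoints1; case: (boolP (i \in L)) => iL /=.
  by rewrite w0 iLR iL scaler0.
rewrite wZ wedge_basis.
have dLR : [disjoint L & R].
  by apply/pred0P => t /=; rewrite !inE; case: ltngtP; rewrite ?andbF.
rewrite -setI_eq0 setIUl setU_eq0 !setI_eq0 dLR disjoints1 iLR (negPf iL) /=.
case: (boolP (i \in R)) => iR /=; first by rewrite !scaler0.
have iS : i \notin S :\ s by rewrite iLR negb_or iL.
rewrite !scalerA; congr (_ *: ext_basis _); last first.
  apply/setP => t; rewrite !inE -[t == s]val_eqE.
  case: (t == i); rewrite /= ?orbT //= orbF.
  by case: (t \in S); rewrite ?andbF //=; case: ltngtP.
have -> : inversions L [set i] = #|[set t in S | (i < t < s)%N]|.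
  rewrite /inversions -[RHS](card_imset _ (f := fun t => (t, i))); last by move=> t u [].
  apply: eq_card => -[t u]; rewrite !inE /=; apply/idP/imsetP => /=.
    case/andP=> /andP[/andP[tS ts] /eqP ->] it.
    by exists t; rewrite // !inE tS ts it.
  by case=> t'; rewrite !inE => /and3P[tS it ts] [-> ->]; rewrite tS ts it eqxx.
have -> : inversions (L :|: [set i]) R = #|[set t in S | (s < t < i)%N]|.
  rewrite /inversions -[RHS](card_imset _ (f := fun t => (i, t))); last by move=> t u [].
  apply: eq_card => -[t u]; rewrite !inE /=; apply/idP/imsetP => /=.
    case/andP=> /andP[/orP[/andP[tS ts]|/eqP->] /andP[uS su]] ut.
      by move: (ltn_trans (ltn_trans ut ts) su); rewrite ltnn.
    by exists u; rewrite // !inE uS su ut.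
  by case=> t'; rewrite !inE => /and3P[tS it ts] [-> ->]; rewrite tS ts it eqxx orbT.
rewrite ksignD // /ksign !card_signE.
have -> : (-1) ^+ (s < i)%N = \prod_(t in S) (-1) ^+ ((t == s) && (s < i)%N) :> F.
  rewrite (bigD1 s) //= eqxx big1 ?mulr1 // => t /andP[_ /negPf->] //.
rewrite -!big_split /=; apply: eq_bigr => t tS.
have [-> | ts] := eqVneq t s.
  by rewrite !ltnn !andbF /=; case: (s < i)%N; rewrite ?mulr1 ?mulrNN ?mulr1.
have ti : t != i by apply: contraNneq iS => <-; rewrite !inE ts.
move: ts ti; rewrite -!val_eqE /= mul1r => ts ti.
by case: (ltngtP t s) ts => //; case: (ltngtP t i) ti => //;
   rewrite /= ?expr0 ?expr1 ?mulr1 ?mul1r ?mulrNN ?mulr1.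
Qed.

Lemma wedge_sum e1 e2 (c : 'I_n -> F) :
  wedge (wedge e1 (\sum_i c i *: ext_basis [set i])) e2
  = \sum_i c i *: wedge (wedge e1 (ext_basis [set i])) e2.
Proof.
pose g y := wedge (wedge e1 y) e2.
have g_lin : linear g.
  by move=> a y z; rewrite /g wedge_linear_r wedge_linear_l.
pose gL := HB.pack_for {linear ext -> ext} g
  (GRing.isLinear.Build _ _ _ _ _ g_lin).
rewrite -[LHS]/(gL _) linear_sum; apply: eq_bigr => i _.
by rewrite linearZ.
Qed.

Lemma ext_act_cran A x :
  ext_act A x = \sum_(i < n) \sum_(s < n) A i s *: cr i (an s x).
Proof.
rewrite ext_actE /ext_act_fun.
have xE : x = \sum_S x S *: ext_basis S.
  apply/ffunP => T; rewrite sum_ffunE (bigD1 T) //= big1 ?addr0.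
    by rewrite !ffunE eqxx [RHS]mulr1.
  by move=> S neS; rewrite !ffunE eq_sym (negPf neS) scaler0.
rewrite [in RHS]xE.
under [RHS]eq_bigr do under eq_bigr do rewrite !linear_sum ?scaler_sumr.
under [RHS]eq_bigr do rewrite exchange_big.
rewrite [RHS]exchange_big; apply: eq_bigr => S _ /=.
rewrite exchange_big /ext_act_basis scaler_sumr [LHS]big_mkcond.
apply: eq_bigr => s _ /=; case: ifP => sS; last first.
  rewrite big1 // => i _.
  by rewrite !linearZ /= an_basis sS linear0 !scaler0.
rewrite /ext_vec.
rewrite wedge_sum scaler_sumr; apply: eq_bigr => i _.
by rewrite mxE !linearZ /= wedge_replace // !scalerA mulrC.
Qed.

Fact ext_linear : linear ext_act.
Proof.
move=> a A B; apply/lfunP => x.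
rewrite (add_lfunE (a *: ext_act A)) (scale_lfunE a (ext_act A)).
rewrite (ext_act_cran _ x) (ext_act_cran A x) (ext_act_cran B x).
rewrite scaler_sumr -big_split.
apply: eq_bigr => i _ /=; rewrite scaler_sumr -big_split.
by apply: eq_bigr => s _ /=; rewrite !mxE scalerDl scalerA.
Qed.

Lemma cran_comm i j k l x :
  cr i (an j (cr k (an l x))) - cr k (an l (cr i (an j x)))
  = (j == k)%:R *: cr i (an l x) - (l == i)%:R *: cr k (an j x).
Proof.
have E (a b c : 'I_n) y :
    cr a (an b (cr c y)) = (b == c)%:R *: cr a y - cr a (cr c (an b y)).
  by rewrite car_an_cr linearB linearZ.
rewrite (E i j k (an l x)) (E k l i (an j x)).
have -> : cr k (cr i (an l (an j x))) = cr i (cr k (an j (an l x))).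
  by rewrite (car_cr_cr k i) (car_an_an l j x) !linearN opprK.
exact: subr_cancel.
Qed.

Fact ext_bracket (A B : 'M[F]_n) :
  ext_act (A *m B - B *m A)
  = ((ext_act A \o ext_act B) - (ext_act B \o ext_act A))%VF.
Proof.
apply: lfun_commP => x.
have E (P Q : 'M[F]_n) : ext_act P (ext_act Q x) =
    \sum_i \sum_j \sum_k \sum_l (P i j * Q k l) *: cr i (an j (cr k (an l x))).
  rewrite ext_act_cran; apply: eq_bigr => i _; apply: eq_bigr => j _.
  rewrite ext_act_cran !linear_sum ?scaler_sumr; apply: eq_bigr => k _.
  rewrite !linear_sum ?scaler_sumr; apply: eq_bigr => l _.
  rewrite -[LHS]/(P i j *: cr i (an j (Q k l *: cr k (an l x)))).
  by rewrite 2!linearZ scalerA.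
have E' : ext_act B (ext_act A x) =
    \sum_i \sum_j \sum_k \sum_l (A i j * B k l) *: cr k (an l (cr i (an j x))).
  rewrite E; under eq_bigr do rewrite exchange_big.
  rewrite exchange_big; apply: eq_bigr => i _ /=.
  under eq_bigr do rewrite exchange_big.
  rewrite exchange_big; apply: eq_bigr => j _ /=.
  apply: eq_bigr => k _; apply: eq_bigr => l _.
  by rewrite mulrC.
rewrite E E' -sumrB.
under [RHS]eq_bigr do rewrite -sumrB.
under [RHS]eq_bigr do under eq_bigr do rewrite -sumrB.
under [RHS]eq_bigr do under eq_bigr do under eq_bigr do rewrite -sumrB.
under [RHS]eq_bigr do under eq_bigr do under eq_bigr do under eq_bigr do
  rewrite -scalerBr cran_comm scalerBr !scalerA.
under [RHS]eq_bigr do under eq_bigr do under eq_bigr do rewrite sumrB.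
under [RHS]eq_bigr do under eq_bigr do rewrite sumrB.
under [RHS]eq_bigr do rewrite sumrB.
rewrite [RHS]sumrB ext_act_cran.
have -> : \sum_i \sum_j (A *m B - B *m A) i j *: cr i (an j x) =
  \sum_i \sum_j (A *m B) i j *: cr i (an j x) -
  \sum_i \sum_j (B *m A) i j *: cr i (an j x).
  rewrite -sumrB; apply: eq_bigr => i _; rewrite -sumrB; apply: eq_bigr => j _.
  by rewrite !mxE scalerBl.
congr (_ - _).
  apply: eq_bigr => i _; rewrite exchange_big /=.
  under [RHS]eq_bigr do rewrite exchange_big.
  rewrite [RHS]exchange_big; apply: eq_bigr => l _ /=.
  rewrite mxE scaler_suml exchange_big /=; apply: eq_bigr => j _.
  rewrite (bigD1 j) //= eqxx mulr1 big1 ?addr0 // => k.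
  by rewrite eq_sym => /negPf->; rewrite mulr0 scale0r.
rewrite [RHS]exchange_big [LHS]exchange_big; apply: eq_bigr => j _ /=.
rewrite [RHS]exchange_big; apply: eq_bigr => k _ /=.
rewrite mxE scaler_suml; apply: eq_bigr => i _.
rewrite (bigD1 i) //= eqxx mulr1 mulrC big1 ?addr0 // => l /negPf->.
by rewrite mulr0 scale0r.
Qed.

Definition exterior_rep : glrep F n := GLRep ext_linear ext_bracket.

End Exterior.

(** * Binomial coefficients with an integer lower entry *)

(* Truncated subtraction on nat would give 'C(a, 0) = 1 for a negative b. *)
Definition binz (a : nat) (b : int) : nat :=
  if b is Posz m then 'C(a, m) else 0.

(* Main.v *)
(* By the Hermitian form for which E_ij and E_ji are adjoint, representations of
   the kind considered here are semisimple, and the multiplicity of V(la) is the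
   dimension of the space of highest weight vectors of weight la.

   Let W be such a representation and A the exterior algebra. A highest weight
   vector of A (x) W has a leading component e_S (x) w, where w is a highest
   weight vector of W, of weight la - 1_S. Conversely every such w occurs: the
   map y |-> \sum_T e_T (x) a_T y, where the a_T are products of annihilation
   operators, is an equivariant map from A^{(x) l} to A (x) A^{(x) l}, and it
   sends the highest weight vector of weight la made of exterior products to one
   whose component along e_S pairs nontrivially with the similar vector of
   weight la - 1_S; mapping the latter to w gives the required vector. Hence the
   multiplicities m_k(la) satisfy m_(k+1)(la) = \sum_S m_k(la - 1_S) (Pieri's
   rule), the term vanishing if la - 1_S is not dominant.

   By Pascal's rule and multilinearity in the columns, det['C(k, la_(n-j) + j - i)]
   satisfies the same recursion, nondominant terms having two equal columns.
   Vandermonde's convolution writes the matrix of the theorem as the product of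
   a unitriangular matrix and this one. *)
Require Import Defs.
From HB Require Import structures.
From mathcomp Require Import all_boot all_order all_algebra.
From mathcomp Require Import boolp reals complex.
From mathcomp Require Import zify ring.

Set Implicit Arguments.
Unset Strict Implicit.
Unset Printing Implicit Defensive.

Import Order.TTheory GRing.Theory Num.Theory.
Local Open Scope ring_scope.

(** * Linear algebra preliminaries *)

Lemma linear_lfun (K : fieldType) (U V : vectType K) (f : U -> V) :
  linear f -> {g : 'Hom(U, V) | g =1 f}.
Proof.
move=> f_lin; pose fL := HB.pack_for {linear U -> V} f
  (GRing.isLinear.Build _ _ _ _ f f_lin).
by exists (linfun fL) => x; rewrite (lfunE fL).
Qed.

(** Each linear form cuts the dimension by at most one. *)
Lemma dimv_bigcap_lker (K : fieldType) (V : vectType K) (I : Type) (r : seq I)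
    (f : I -> 'Hom(V, line K)) (U : {vspace V}) :
  (\dim U <= \dim (U :&: \bigcap_(i <- r) lker (f i))%VS + size r)%N.
Proof.
elim: r U => [|i r IHr] U; first by rewrite big_nil capvf addn0.
rewrite big_cons capvA -(limg_ker_dim (f i) U) addnS addnC.
apply: leq_trans (leq_add (dimvS (subvf _)) (IHr _)) _.
by rewrite (dimvf (line K)).
Qed.

(** * Matrix units, highest weight spaces and the submodules they generate *)

Section GlAction.
Variables (K : fieldType) (n : nat).
Implicit Types (M : glrep K n) (i j k l : 'I_n).

Definition gE M i j : 'End(M) := glact M (delta_mx i j).

Lemma glact_gE M (A : 'M[K]_n) x : glact M A x = \sum_i \sum_j A i j *: gE M i j x.
Proof.
have g_lin : linear (fun A : 'M[K]_n => glact M A x).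
  by move=> a B C; rewrite glact_linear add_lfunE scale_lfunE.
have [g gE'] := linear_lfun g_lin.
rewrite -gE' {1}[A]matrix_sum_delta linear_sum; apply: eq_bigr => i _.
by rewrite linear_sum; apply: eq_bigr => j _; rewrite linearZ /= gE'.
Qed.

Lemma gE_comm M i j k l x :
  gE M i j (gE M k l x) =
  gE M k l (gE M i j x) + ((j == k)%:R *: gE M i l x - (l == i)%:R *: gE M k j x).
Proof.
have := glact_bracket M (delta_mx i j) (delta_mx k l).
rewrite !mul_delta_mx_cond => /lfunP/(_ x); rewrite sub_lfunE !comp_lfunE => E.
apply/eqP; rewrite addrC -subr_eq -/(gE M _ _) -E; apply/eqP.
have g_lin : linear (fun A : 'M[K]_n => glact M A x).
  by move=> a B C; rewrite glact_linear add_lfunE scale_lfunE.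
have [g gE'] := linear_lfun g_lin.
by rewrite -gE' linearB !raddfMn /= !gE' !scaler_nat mulNrn.
Qed.

Lemma stableP M (U : {vspace M}) :
  stable U <-> forall i j x, x \in U -> gE M i j x \in U.
Proof.
split=> [stU i j x xU | stU A]; first exact: subvP (stU _) _ (memv_img _ xU).
apply/subvP => _ /memv_imgP[x xU ->]; rewrite glact_gE.
by apply: rpred_sum => i _; apply: rpred_sum => j _; rewrite rpredZ ?stU.
Qed.

Lemma equivariantP (L M : glrep K n) (f : 'Hom(L, M)) :
  equivariant f <-> forall i j x, f (gE L i j x) = gE M i j (f x).
Proof.
split=> [ef i j x | ef A]; first by have /lfunP/(_ x) := ef (delta_mx i j); rewrite !comp_lfunE.
apply/lfunP => x; rewrite !comp_lfunE !glact_gE linear_sum; apply: eq_bigr => i _.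
by rewrite linear_sum; apply: eq_bigr => j _; rewrite linearZ /= ef.
Qed.

Lemma stable_cap M (U V : {vspace M}) : stable U -> stable V -> stable (U :&: V)%VS.
Proof.
move=> /stableP sU /stableP sV; apply/stableP => i j x /memv_capP[xU xV].
by rewrite memv_cap sU ?sV.
Qed.

(* Weights are integral, so that la - 1_S makes sense for every S. *)
Definition hwspace M (mu : 'I_n -> int) : {vspace M} :=
  ((\bigcap_(p : 'I_n * 'I_n | (p.1 < p.2)%N) lker (gE M p.1 p.2))
   :&: \bigcap_i lker (gE M i i - (mu i)%:~R *: \1%VF))%VS.

Lemma hwspaceP M mu (x : M) :
  reflect ((forall i j, (i < j)%N -> gE M i j x = 0)
           /\ (forall i, gE M i i x = (mu i)%:~R *: x))
          (x \in hwspace M mu).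
Proof.
rewrite memv_cap; apply: (iffP andP) => -[].
  rewrite 2!memvE => /subv_bigcapP up /subv_bigcapP wt; split=> [i j ij | i].
    by have := up (i, j) ij; rewrite -memvE memv_ker => /eqP.
  have := wt i isT; rewrite -memvE memv_ker.
  by rewrite sub_lfunE scale_lfunE id_lfunE subr_eq0 => /eqP.
move=> up wt; rewrite 2!memvE; split; apply/subv_bigcapP.
  by move=> [i j] ij; rewrite -memvE memv_ker up.
by move=> i _; rewrite -memvE memv_ker sub_lfunE scale_lfunE id_lfunE wt subrr.
Qed.

Lemma eq_hwspace M mu nu : mu =1 nu -> hwspace M mu = hwspace M nu.
Proof. by move=> /funext ->. Qed.

Lemma equivariant_hw (L M : glrep K n) (f : 'Hom(L, M)) mu x :
  equivariant f -> x \in hwspace L mu -> f x \in hwspace M mu.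
Proof.
move=> /equivariantP ef /hwspaceP[up wt]; apply/hwspaceP; split=> [i j ij | i].
  by rewrite -ef up ?linear0.
by rewrite -ef wt linearZ.
Qed.

(** This is n_- U for the strictly lower triangular subalgebra n_-. [U] itself is not added, so that
    a highest weight vector may lie outside [lowered fullv]. *)
Definition lowered M (U : {vspace M}) : {vspace M} :=
  (\sum_(p : 'I_n * 'I_n | (p.2 < p.1)%N) gE M p.1 p.2 @: U)%VS.

Lemma lowered_img M (U : {vspace M}) i j x :
  (j < i)%N -> x \in U -> gE M i j x \in lowered U.
Proof.
move=> ji xU.
by rewrite memvE (sumv_sup (i, j)) //= -memvE memv_img.
Qed.

Lemma loweredS M (U V : {vspace M}) : (U <= V)%VS -> (lowered U <= lowered V)%VS.
Proof.
move=> UV; apply/subv_sumP => -[i j] ji.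
by rewrite (sumv_sup (i, j)) // limgS.
Qed.

(* A minimal subspace containing [x] and closed under lowering is a submodule:
   the [z] in it with [A z] in it for all [A] form a subspace of the same kind. *)
Lemma hw_generated M mu (x : M) : x \in hwspace M mu ->
  exists Z : {vspace M}, [/\ x \in Z, stable Z &
    forall U : {vspace M}, x \in U -> (lowered U <= U)%VS -> (Z <= U)%VS].
Proof.
move=> /hwspaceP[up wt].
pose good (d : nat) := `[< exists Z : {vspace M}, [/\ x \in Z, (lowered Z <= Z)%VS & \dim Z = d] >].
have exd : exists d, good d by exists (\dim {:M}); apply/asboolP; exists fullv; rewrite memvf subvf.
case: (ex_minnP exd) => d /asboolP[Z [xZ lZ dZ]] minZ.
have lowP (U : {vspace M}) : (lowered U <= U)%VS ->
    forall i j y, (j < i)%N -> y \in U -> gE M i j y \in U.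
  by move=> lU i j y ji yU; apply: subvP lU _ (lowered_img ji yU).
(* [Z] has least dimension; intersecting it with [U] shows that it is even contained in every such
   [U]. *)
have Zmin (U : {vspace M}) : x \in U -> (lowered U <= U)%VS -> (Z <= U)%VS.
  move=> xU lU; apply/capv_idPl/eqP; rewrite -(geq_leqif (dimv_leqif_eq _)) ?capvSl //.
  rewrite dZ; apply: minZ; apply/asboolP; exists (Z :&: U)%VS; split=> //.
    by rewrite memv_cap xZ.
  by rewrite subv_cap (subv_trans _ lZ) ?(subv_trans _ lU) ?loweredS ?capvSl ?capvSr.
exists Z; split=> //.
pose T := (Z :&: \bigcap_(p : 'I_n * 'I_n) (gE M p.1 p.2 @^-1: Z))%VS.
have TP y : reflect (y \in Z /\ forall i j, gE M i j y \in Z) (y \in T).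
  rewrite memv_cap; apply: (iffP andP) => -[yZ].
    rewrite memvE => /subv_bigcapP yT; split=> // i j.
    by have := yT (i, j) isT; rewrite -memvE -memv_preim.
  move=> yT; split=> //; rewrite memvE; apply/subv_bigcapP => -[i j] _.
  by rewrite -memvE -memv_preim yT.
have /subvP ZT : (Z <= T)%VS.
  apply: Zmin.
    apply/TP; split=> // i j; case: (ltngtP i j) => [ij | ji | /val_inj ->].
    - by rewrite up ?mem0v.
    - exact: lowP.
    - by rewrite wt rpredZ.
  apply/subv_sumP => -[i j] /= ji; apply/subvP => _ /memv_imgP[y /TP[yZ yT] ->].
  apply/TP; split=> [|k l]; first exact: yT.
  rewrite gE_comm rpredD ?(lowP _ lZ i j) ?yT //.
  by rewrite rpredB ?rpredZ ?yT.
by apply/stableP => i j y /ZT/TP[].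
Qed.

(** The right-hand side contains [x] and lies in [Z], so lowering sends it into [lowered Z], and
    minimality of [Z] applies. *)
Lemma hw_cyclic M (Z : {vspace M}) (x : M) : x \in Z -> stable Z ->
  (forall U : {vspace M}, x \in U -> (lowered U <= U)%VS -> (Z <= U)%VS) ->
  (Z <= <[x]> + lowered Z)%VS.
Proof.
move=> xZ /stableP stZ Zmin; apply: (Zmin).
  by rewrite memvE addvSl.
apply: subv_trans (addvSr _ _); apply: loweredS; rewrite subv_add -memvE xZ.
by apply/subv_sumP => -[i j] ji; apply/subvP => _ /memv_imgP[y yZ ->]; apply: stZ.
Qed.

(** The summands are stable and independent, so the components of a highest weight vector satisfy
    the defining linear equations separately. *)
Lemma hw_dim_sum (M : glrep K n) r (V : 'I_r -> {vspace M}) mu : irreducible_decomposition V ->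
  \dim (hwspace M mu) = (\sum_(s < r) \dim (V s :&: hwspace M mu)%VS)%N.
Proof.
move=> [irrV dirV sumV].
have dirH : directv (\sum_(s < r) (V s :&: hwspace M mu))%VS.
  apply/directv_sum_independent => us usV us0 s _.
  apply: (directv_sum_independent dirV) us0 s isT => t _.
  by have /memv_capP[] := usV t isT.
have hwE : hwspace M mu = (\sum_(s < r) (V s :&: hwspace M mu))%VS.
  apply/eqP; rewrite eqEsubv andbC; apply/andP; split.
    by apply/subv_sumP => s _; exact: capvSr.
  apply/subvP => x xH; have : x \in (\sum_(s < r) V s)%VS by rewrite sumV memvf.
  case/memv_sumP => us usV xE; rewrite xE; apply: memv_sumr => s _.
  rewrite memv_cap usV //=; have /hwspaceP[up wt] := xH.
  have stV t i j y : y \in V t -> gE M i j y \in V t.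
    by case: (irrV t) => /stableP st _ _; apply: st.
  apply/hwspaceP; split=> [i j ij | i].
    apply: (directv_sum_independent dirV (fun t => gE M i j (us t))) => // [t _|].
      exact/stV/usV.
    by transitivity (gE M i j x); [rewrite xE linear_sum | exact: up].
  apply/eqP; rewrite -subr_eq0; apply/eqP.
  apply: (directv_sum_independent dirV (fun t => gE M i i (us t) - (mu i)%:~R *: us t)) => // [t _|].
    by rewrite rpredB ?rpredZ ?usV //; exact/stV/usV.
  by rewrite sumrB -scaler_sumr -xE -wt [in X in _ - X]xE linear_sum subrr.
by rewrite {1}hwE; move: dirH; rewrite directvE => /eqP.
Qed.

End GlAction.

(** * Contravariant Hermitian forms and semisimplicity *)

Section ContravariantForm.
Variables (F : numClosedFieldType) (n : nat).

(** Over the complex numbers this is a Hermitian inner product invariant under the Lie algebra u(n),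
    expressed through matrix units. *)
Record contravariant_form (M : glrep F n) (B : M -> M -> F) : Prop := ContraForm {
  cformDZ : forall a x y z, B (a *: x + y) z = a * B x z + B y z;
  cformC : forall x y, B x y = (B y x)^*;
  cform_gt0 : forall x, x != 0 -> 0 < B x x;
  cform_gE : forall i j x y, B (gE M i j x) y = B x (gE M j i y) }.

Variables (M : glrep F n) (B : M -> M -> F) (HB : contravariant_form B).
Implicit Types (U V : {vspace M}) (x y : M).

Lemma cform_lfun y : {g : 'Hom(M, line F) | g =1 B^~ y}.
Proof. by apply: linear_lfun => a x z; rewrite (cformDZ HB). Qed.

Lemma cform0 y : B 0 y = 0.
Proof. by have [g gP] := cform_lfun y; rewrite -[LHS]gP linear0. Qed.

Lemma cformr0 x : B x 0 = 0.
Proof. by rewrite (cformC HB) cform0 conjC0. Qed.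

Lemma cformZ a x y : B (a *: x) y = a * B x y.
Proof. by rewrite -[a *: x]addr0 (cformDZ HB) cform0 addr0. Qed.

Lemma cformD x z y : B (x + z) y = B x y + B z y.
Proof. by rewrite -[x]scale1r (cformDZ HB) scale1r mul1r. Qed.

Lemma cformZr a x y : B x (a *: y) = a^* * B x y.
Proof. by rewrite (cformC HB) cformZ rmorphM /= -(cformC HB). Qed.

Lemma cformDr x y z : B x (y + z) = B x y + B x z.
Proof. by rewrite (cformC HB) cformD rmorphD /= -!(cformC HB). Qed.

Lemma cform_sum I (r : seq I) (P : pred I) f y :
  B (\sum_(i <- r | P i) f i) y = \sum_(i <- r | P i) B (f i) y.
Proof.
have [g gP] := cform_lfun y; rewrite -[LHS]gP linear_sum.
by apply: eq_bigr => i _; rewrite /= gP.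
Qed.

Lemma cform_eq0 x : (B x x == 0) = (x == 0).
Proof.
have [->|/(cform_gt0 HB)/gt_eqF->] //= := eqVneq x 0.
by rewrite cform0 eqxx.
Qed.

Lemma cform_orthC x y : B x y = 0 -> B y x = 0.
Proof. by move=> xy; rewrite (cformC HB) xy conjC0. Qed.

(** Testing only a basis of [U] makes it visible that the codimension is at most [\dim U]. *)
Definition orth U : {vspace M} :=
  (\bigcap_(i < \dim U) lker (sval (cform_lfun (vbasis U)`_i)))%VS.

Lemma orthP U x : reflect (forall y, y \in U -> B x y = 0) (x \in orth U).
Proof.
apply: (iffP idP) => [xU y | xU].
  move/coord_vbasis ->; apply: cform_orthC; rewrite cform_sum big1 // => i _.
  rewrite cformZ; apply/eqP; rewrite mulf_eq0; apply/orP; right; apply/eqP.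
  apply: cform_orthC.
  move: xU; rewrite memvE => /subv_bigcapP/(_ i isT).
  by rewrite -memvE memv_ker; case: cform_lfun => g /= gP; rewrite gP => /eqP.
rewrite memvE; apply/subv_bigcapP => i _.
rewrite -memvE memv_ker; case: cform_lfun => g /= gP; rewrite gP; apply/eqP.
by apply/xU/vbasis_mem/mem_nth; rewrite size_tuple.
Qed.

Lemma capv_orth U : (U :&: orth U = 0)%VS.
Proof.
apply/eqP; rewrite -subv0; apply/subvP => x /memv_capP[xU /orthP/(_ x xU)/eqP].
by rewrite cform_eq0 memv0.
Qed.

(** The two summands meet in zero, and [orth U] is cut out by [\dim U] linear forms, so the
    dimensions suffice. *)
Lemma addv_orth U : (U + orth U = fullv)%VS.
Proof.
apply/eqP; rewrite -(geq_leqif (dimv_leqif_eq (subvf _))).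
rewrite dimv_disjoint_sum ?capv_orth //.
apply: leq_trans (dimv_bigcap_lker (enum 'I_(\dim U))
  (fun i => sval (cform_lfun (vbasis U)`_i)) _) _.
by rewrite capfv big_enum size_enum_ord addnC.
Qed.

Lemma orth_stable U : stable U -> stable (orth U).
Proof.
move=> /stableP stU; apply/stableP => i j x /orthP xU; apply/orthP => y yU.
by rewrite (cform_gE HB) xU ?stU.
Qed.

Definition orthproj U : 'End(M) := daddv_pi U (orth U).

Lemma orthproj_mem U x : orthproj U x \in U.
Proof. exact: memv_pi. Qed.

Lemma orthproj_id U x : x \in U -> orthproj U x = x.
Proof. exact: daddv_pi_id (capv_orth U). Qed.

Lemma orthproj_orth U x : x - orthproj U x \in orth U.
Proof.
rewrite -{1}[x](daddv_pi_add (capv_orth U)) ?addv_orth ?memvf //.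
by rewrite addrC addKr memv_pi.
Qed.

Lemma orthprojE U x y : y \in U -> B (orthproj U x) y = B x y.
Proof.
move=> yU; rewrite -{2}[x](subrK (orthproj U x)) cformD.
by rewrite (orthP _ _ (orthproj_orth U x)) ?add0r.
Qed.

(** [U] and [orth U] are both stable, so matrix units respect the decomposition of [x] along
    them. *)
Lemma orthproj_equivariant U : stable U -> equivariant (orthproj U).
Proof.
move=> stU; apply/equivariantP => i j x; set p := orthproj U.
have pU : p x \in U by exact: orthproj_mem.
have /stableP stO := orth_stable stU; move/stableP: stU => stU.
pose y := gE M i j (x - p x); have yO : y \in orth U.
  by apply: stO; exact: orthproj_orth.
have -> : gE M i j x = y + gE M i j (p x) by rewrite -linearD subrK.
rewrite linearD /= [p (gE M i j (p x))]orthproj_id ?stU //.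
suff -> : p y = 0 by rewrite add0r.
apply/eqP; rewrite -cform_eq0; apply/eqP; rewrite orthprojE ?orthproj_mem //.
by apply: (orthP _ _ yO); exact: orthproj_mem.
Qed.

(** A lowering operator moved to the other argument becomes a raising operator, which kills [y]. *)
Lemma cform_lowered U x y : (forall i j : 'I_n, (i < j)%N -> gE M i j y = 0) ->
  x \in lowered U -> B x y = 0.
Proof.
move=> up /memv_sumP[f fU ->]; rewrite cform_sum big1 // => -[i j] /= ji.
have /memv_imgP[z _ ->] := fU (i, j) ji.
by rewrite (cform_gE HB) up ?cformr0.
Qed.

(** For a highest weight vector [x] and i < j, B(E_ji x, E_ji x) = (mu_i - mu_j) B(x, x); positivity
    excludes mu_i < mu_j unless x = 0. *)
Lemma hw_dominant mu : (exists i j : 'I_n, (i < j)%N /\ mu i < mu j) -> hwspace M mu = 0%VS.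
Proof.
case=> i [j [ij mu_ij]]; apply/eqP; rewrite -subv0; apply/subvP => x xH.
have /hwspaceP[up wt] := xH; rewrite memv0.
apply/negPn/negP => x_neq0.
have E : B (gE M j i x) (gE M j i x) = (mu i - mu j)%:~R * B x x.
  rewrite (cformC HB) (cform_gE HB) -(cformC HB) (gE_comm) up // linear0 add0r !eqxx.
  by rewrite !scale1r !wt -scalerBl -rmorphB cformZ.
have ge0 : 0 <= B (gE M j i x) (gE M j i x).
  by have [->|/(cform_gt0 HB)/ltW] // := eqVneq (gE M j i x) 0; rewrite cform0.
by move: ge0; rewrite E pmulr_lge0 ?(cform_gt0 HB) // ler0z subr_ge0 leNgt mu_ij.
Qed.

Lemma irreducible_sub_exists U : stable U -> U != 0%VS ->
  exists2 V, irreducible_sub V & (V <= U)%VS.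
Proof.
move=> stU U_neq0.
pose good (d : nat) := `[< exists V, [/\ stable V, V != 0%VS, (V <= U)%VS & \dim V = d] >].
have exd : exists d, good d by exists (\dim U); apply/asboolP; exists U.
case: (ex_minnP exd) => d /asboolP[V [stV V_neq0 VU dV]] minV.
exists V => //; split=> //; first exact/eqP.
move=> W WV stW; have [->|W_neq0] := eqVneq W 0%VS; [by left | right].
apply/eqP; rewrite -(geq_leqif (dimv_leqif_eq WV)) dV; apply: minV.
by apply/asboolP; exists W; rewrite (subv_trans WV).
Qed.

(** Induction on the dimension: an irreducible [V] inside [U] splits off, with the stable complement
    [U :&: orth V]. *)
Lemma semisimple U : stable U -> exists r (V : 'I_r -> {vspace M}),
  [/\ forall s, irreducible_sub (V s), directv (\sum_(s < r) V s)%VS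
    & (\sum_(s < r) V s)%VS = U].
Proof.
have [d] := ubnP (\dim U); elim: d U => // d IHd U; rewrite ltnS => dU stU.
have [->|U_neq0] := eqVneq U 0%VS.
  exists 0%N, (fun=> 0%VS); split=> [[] //||]; rewrite ?big_ord0 //.
  by rewrite directvE /= !big_ord0 dimv0.
have [V irrV VU] := irreducible_sub_exists stU U_neq0; have [stV V0 _] := irrV.
pose W := (U :&: orth V)%VS.
have VW0 : (V :&: W = 0)%VS.
  apply/eqP; rewrite -subv0 -(capv_orth V) /W.
  by rewrite subv_cap capvSl (subv_trans (capvSr _ _) (capvSr _ _)).
have UE : (V + W = U)%VS.
  apply/eqP; rewrite eqEsubv subv_add VU capvSl /=.
  apply/subvP => x xU; rewrite -[x](subrK (orthproj V x)) addrC memv_add ?orthproj_mem //.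
  by rewrite memv_cap orthproj_orth rpredB // (subvP VU) ?orthproj_mem.
have dW : (\dim W < d)%N.
  apply: leq_trans dU; rewrite -UE dimv_disjoint_sum // -{1}[\dim W]add0n ltn_add2r.
  by rewrite lt0n dimv_eq0; apply/eqP.
have stW : stable W by apply: stable_cap (orth_stable _).
have [r [T [irrT dirT sumT]]] := IHd W dW stW.
pose T' s := oapp T V (unlift ord0 s).
have T'0 : T' ord0 = V by rewrite /T' unlift_none.
have T'S s : T' (lift ord0 s) = T s by rewrite /T' liftK.
exists r.+1, T'; split.
- by move=> s; rewrite /T'; case: unliftP => [j|] _ /=.
- rewrite directvE /= !big_ord_recl T'0; under eq_bigr do rewrite T'S.
  under [X in _ == (_ + X)%N]eq_bigr do rewrite T'S.
  rewrite sumT dimv_disjoint_sum // eqn_add2l -sumT.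
  by move: dirT; rewrite directvE.
- by rewrite big_ord_recl T'0; under eq_bigr do rewrite T'S; rewrite sumT.
Qed.

(** A nonzero highest weight vector [x] generates [U], so U = <x> + lowered U. Given another vector
    [y] of the same weight, its part [z] orthogonal to [x] is also orthogonal to [lowered U], hence
    to itself. *)
Lemma hw_irreducible_dim U mu : irreducible_sub U -> (\dim (U :&: hwspace M mu) <= 1)%N.
Proof.
move=> [stU _ irrU]; have [->|] := eqVneq (U :&: hwspace M mu)%VS 0%VS.
  by rewrite dimv0.
rewrite -vpick0; set x := vpick _ => x_neq0.
have /memv_capP[xU xH] : x \in (U :&: hwspace M mu)%VS by exact: memv_pick.
have [Z [xZ stZ Zmin]] := hw_generated xH.
have ZU : Z = U.
  have ZU : (Z <= U)%VS.
    apply: Zmin => //; apply/subv_sumP => -[i j] _.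
    by apply/subvP => _ /memv_imgP[y yU ->]; apply: (stableP U).1.
  case: (irrU Z) => // Z0; move: xZ; rewrite Z0 memv0 => /eqP x0.
  by rewrite x0 eqxx in x_neq0.
have dx : \dim <[x]>%VS = 1%N by rewrite dim_vline x_neq0.
rewrite -dx; apply: dimvS.
apply/subvP => y /memv_capP[yU yH].
pose z := y - orthproj <[x]>%VS y; suff: z == 0.
  by rewrite subr_eq0 => /eqP ->; exact: orthproj_mem.
have /vlineP[c pE] := orthproj_mem <[x]>%VS y.
have zH : z \in hwspace M mu by rewrite rpredB // pE rpredZ.
have zU : z \in U by rewrite rpredB // pE rpredZ.
have := subvP (hw_cyclic xZ stZ Zmin) z; rewrite ZU => /(_ zU).
case/memv_addP => _ /vlineP[a ->] [t tL zE].
rewrite -cform_eq0 {1}zE cformD cformZ (cform_lowered _ tL); last by case/hwspaceP: zH.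
by rewrite addr0 cform_orthC ?mulr0 //; apply: (orthP _ _ (orthproj_orth _ y)); rewrite memv_line.
Qed.

End ContravariantForm.

(** * The direct sum of two representations *)

Section DirectSum.
Variables (K : fieldType) (n : nat) (V W : glrep K n).
Local Notation sumT := ((V : vectType K) * (W : vectType K))%type.

Definition sum_act_fun (A : 'M[K]_n) (p : sumT) : sumT := (glact V A p.1, glact W A p.2).

Fact sum_act_subproof A : linear (sum_act_fun A).
Proof. by move=> a p q; rewrite /sum_act_fun !linearP. Qed.

Definition sum_act (A : 'M[K]_n) : 'End(sumT) := sval (linear_lfun (sum_act_subproof A)).

Lemma sum_actE A p : sum_act A p = (glact V A p.1, glact W A p.2).
Proof. by rewrite /sum_act; case: linear_lfun => g /= ->. Qed.

Fact sum_linear : linear sum_act.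
Proof.
move=> a A B; apply/lfunP => p.
by rewrite add_lfunE scale_lfunE !sum_actE !glact_linear !add_lfunE !scale_lfunE.
Qed.

Fact sum_bracket (A B : 'M[K]_n) :
  sum_act (A *m B - B *m A) = ((sum_act A \o sum_act B) - (sum_act B \o sum_act A))%VF.
Proof. by apply: lfun_commP => p; rewrite !sum_actE !glact_bracket !sub_lfunE !comp_lfunE. Qed.

Definition sum_rep : glrep K n := GLRep sum_linear sum_bracket.

Lemma sum_gE i j (p : sum_rep) : gE sum_rep i j p = (gE V i j p.1, gE W i j p.2).
Proof. exact: sum_actE. Qed.

Lemma sum_hw mu v w : v \in hwspace V mu -> w \in hwspace W mu ->
  ((v, w) : sum_rep) \in hwspace sum_rep mu.
Proof.
move=> /hwspaceP[upv wtv] /hwspaceP[upw wtw]; apply/hwspaceP.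
split=> [i j ij | i]; rewrite sum_gE /=; first by rewrite upv ?upw.
by rewrite wtv wtw.
Qed.

End DirectSum.

(** * Maps determined by highest weight vectors, and multiplicities *)

Section Transfer.
Variables (F : numClosedFieldType) (n : nat).
Implicit Types V W : glrep F n.

(* The submodule [N] of [V (+) W] generated by [(v, w)] is the graph of a map:
   its intersection with [W] is orthogonal to [w], hence to the projection of
   [N] to [W]. *)
Lemma hw_transfer V W B (HB : @contravariant_form F n W B) mu (v : V) (w : W) :
  v \in hwspace V mu -> w \in hwspace W mu -> v \notin lowered (fullv : {vspace V}) ->
  exists (V1 : {vspace V}) (f : 'Hom(V, W)),
    [/\ stable V1, v \in V1, (V1 <= <[v]> + lowered V1)%VS, f v = w &
        forall i j x, x \in V1 -> f (gE V i j x) = gE W i j (f x)].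
Proof.
move=> vH wH v_low; pose S := sum_rep V W.
have [p1 p1E] : {f : 'Hom(S, V) | forall p, f p = p.1} by apply: linear_lfun.
have [p2 p2E] : {f : 'Hom(S, W) | forall p, f p = p.2} by apply: linear_lfun.
have [i2 i2E] : {f : 'Hom(W, S) | forall y, f y = (0, y)}.
  apply: linear_lfun => a x y; congr (_, _).
  by rewrite -[RHS]/(a *: 0 + 0) scaler0 addr0.
have [N [xN stN minN]] := hw_generated (sum_hw vH wH).
have /stableP stabN := stN.
have p1_gE i j z : p1 (gE S i j z) = gE V i j (p1 z) by rewrite !p1E sum_gE.
have p2_gE i j z : p2 (gE S i j z) = gE W i j (p2 z) by rewrite !p2E sum_gE.
pose K := (i2 @^-1: N)%VS.
have KP y : (y \in K) = ((0, y) \in N) by rewrite -memv_preim i2E.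
have stK : stable K.
  apply/stableP => i j y; rewrite !KP => /(stabN i j).
  by rewrite sum_gE /= linear0.
have wK : w \in orth HB K.
  apply/(orthP HB) => y; rewrite KP => yN.
  have /memv_addP[_ /vlineP[c ->] [t tL yE]] := subvP (hw_cyclic xN stN minN) _ yN.
  have t1 : p1 t \in lowered (fullv : {vspace V}).
    have /memv_sumP[g gN ->] := tL; rewrite linear_sum; apply: memv_sumr => -[i j] /= ji.
    have /memv_imgP[z _ ->] := gN (i, j) ji.
    by rewrite p1_gE memv_img ?memvf.
  have t2 : p2 t \in lowered (fullv : {vspace W}).
    have /memv_sumP[g gN ->] := tL; rewrite linear_sum; apply: memv_sumr => -[i j] /= ji.
    have /memv_imgP[z _ ->] := gN (i, j) ji.
    by rewrite p2_gE memv_img ?memvf.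
  (* The first coordinate of (0, y) vanishes, so c != 0 would put [v] in [lowered fullv]. *)
  have c0 : c = 0.
    apply/eqP/negPn/negP => c_neq0; case/negP: v_low.
    have : p1 (0, y) = 0 by rewrite p1E.
    rewrite yE linearD linearZ /= [p1 (v, w)]p1E /= => /eqP.
    rewrite addr_eq0 => /eqP cv.
    by rewrite -[v](scalerK c_neq0) cv rpredZ // rpredN.
  have -> : y = p2 t.
    by rewrite -[LHS]/((0 : V, y).2) -p2E yE c0 scale0r add0r.
  by apply/(cform_orthC HB)/(cform_lowered HB _ t2); case/hwspaceP: wH.
have K0 y : (0, y) \in N -> y = 0.
  move=> yN; have : y \in orth HB K.
    have /subvP/(_ _ yN) : (N <= p2 @^-1: orth HB K)%VS.
      apply: minN; first by rewrite -memv_preim p2E.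
      apply/subv_sumP => -[i j] /= _; apply/subvP => _ /memv_imgP[z zK ->].
      have /stableP stO := orth_stable HB stK.
      by rewrite -memv_preim p2_gE stO // memv_preim.
    by rewrite -memv_preim p2E.
  move=> yO; have : y \in (K :&: orth HB K)%VS by rewrite memv_cap KP yN.
  by rewrite capv_orth memv0 => /eqP.
(* [g] is the first projection restricted to [N], and [f] is the second projection after a section
   of [g]. Only the values of [f] on [p1 @: N] are meaningful. *)
pose g := (p1 \o projv N)%VF; pose f := ((p2 \o projv N) \o g^-1)%VF.
have fN x : x \in (p1 @: N)%VS -> (x, f x) \in N.
  case/memv_imgP=> z zN xE.
  have gx : g (g^-1%VF x) = x.
    apply: limg_lfunVK; apply/memv_imgP; exists z; rewrite ?memvf //.
    by rewrite comp_lfunE projv_id.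
  rewrite -{1}gx /f !comp_lfunE p1E p2E.
  by case: (projv N _) (memv_proj N (g^-1%VF x)).
exists (p1 @: N)%VS, f.
have fE x y : (x, y) \in N -> f x = y.
  move=> xyN; apply/eqP; rewrite -subr_eq0; apply/eqP/K0.
  have xN1 : x \in (p1 @: N)%VS by apply/memv_imgP; exists (x, y); rewrite ?p1E.
  by have := rpredB (fN _ xN1) xyN; rewrite -[_ - _]/(x - x, f x - y) subrr.
split.
- apply/stableP => i j _ /memv_imgP[z zN ->].
  by rewrite -p1_gE memv_img ?stabN.
- by apply/memv_imgP; exists (v, w); rewrite ?p1E.
- apply/subvP => _ /memv_imgP[z /(subvP (hw_cyclic xN stN minN)) + ->].
  case/memv_addP => _ /vlineP[c ->] [t /memv_sumP[g' gN ->] ->].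
  rewrite linearD linearZ /= [p1 (v, w)]p1E memv_add ?memvZ ?memv_line //.
  rewrite linear_sum; apply: memv_sumr => -[i j] /= ji.
  have /memv_imgP[y yN ->] := gN (i, j) ji.
  by rewrite p1_gE !memv_img.
- exact: fE.
- move=> i j x /fN xN1; apply: fE.
  by have := stabN i j _ xN1; rewrite sum_gE.
Qed.

(* Here [M] carries no form, so that eigenvalues are used instead: [h] is the
   sum of the [i E_ii], and lowering increases its eigenvalues. *)
Lemma hw_notin_lowered (M : glrep F n) mu (v : M) :
  irreducible M -> v != 0 -> v \in hwspace M mu -> v \notin lowered (fullv : {vspace M}).
Proof.
move=> [_ _ irrM] v_neq0 vH; have /hwspaceP[_ wt] := vH.
pose h : 'End(M) := \sum_(i < n) (i%:R : F) *: gE M i i.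
have hE x : h x = \sum_(i < n) (i%:R : F) *: gE M i i x.
  by rewrite sum_lfunE; apply: eq_bigr => i _; rewrite scale_lfunE.
have h_gE i j x : h (gE M i j x) = gE M i j (h x) + (i%:R - j%:R) *: gE M i j x.
  rewrite !hE linear_sum.
  under eq_bigr do rewrite gE_comm scalerDr.
  rewrite big_split; congr (_ + _); first by apply: eq_bigr => k _; rewrite linearZ.
  under eq_bigr do rewrite scalerBr !scalerA.
  rewrite sumrB scalerBl; congr (_ - _).
    rewrite (bigD1 i) //= eqxx mulr1 big1 ?addr0 // => k /negPf ->.
    by rewrite mulr0 scale0r.
  rewrite (bigD1 j) //= eqxx mulr1 big1 ?addr0 // => k.
  by rewrite eq_sym => /negPf ->; rewrite mulr0 scale0r.
pose c : F := \sum_(i < n) i%:R * (mu i)%:~R.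
have hv : h v = c *: v.
  by rewrite hE scaler_suml; apply: eq_bigr => i _; rewrite wt scalerA.
(* The eigenspace of [h] for the eigenvalue c + r; it contains [v] for r = 0. *)
pose K r := lker (h - (c + r%:R) *: \1%VF).
have KP r x : (x \in K r) = (h x == (c + r%:R) *: x).
  by rewrite memv_ker sub_lfunE scale_lfunE id_lfunE subr_eq0.
have gEK (i j : 'I_n) r x : (j < i)%N -> x \in K r -> gE M i j x \in K (r + (i - j))%N.
  move=> ji; rewrite !KP h_gE => /eqP ->; rewrite linearZ -scalerDl.
  by rewrite /= natrD (natrB _ (ltnW ji)) !addrA.
pose U N := (\sum_(r < N) K r.+1)%VS.
have UP N N' : (N <= N')%N -> (U N <= U N')%VS.
  move=> NN'; apply/subv_sumP => r _.
  by rewrite (sumv_sup (widen_ord NN' r)).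
pose good (d : nat) := `[< exists N, \dim (U N) = d >].
have ex_good : exists d, good d by exists (\dim (U 0%N)); apply/asboolP; exists 0%N.
have good_le d : good d -> (d <= \dim {:M})%N.
  by move=> /asboolP[N <-]; apply: dimvS; exact: subvf.
case: (ex_maxnP ex_good good_le) => d /asboolP[N dN] maxN.
(* The dimensions of the [U N] are bounded, so one of these sums contains all eigenspaces [K r] with
   r > 0, and then also everything lowered. *)
have KU r : (K r.+1 <= U N)%VS.
  have -> : U N = U (maxn N r.+1).
    apply/eqP; rewrite -(geq_leqif (dimv_leqif_eq _)) ?UP ?leq_maxl //.
    by rewrite dN maxN //; apply/asboolP; exists (maxn N r.+1).
  have rN : (r < maxn N r.+1)%N by rewrite leq_max leqnn orbT.
  by rewrite (sumv_sup (Ordinal rN)).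
have lowU (i j : 'I_n) x : (j < i)%N -> x \in (<[v]> + U N)%VS -> gE M i j x \in U N.
  move=> ji /memv_addP[_ /vlineP[a ->] [y yU ->]]; rewrite linearD linearZ /=.
  have KU' r z : (0 < r)%N -> z \in K r -> z \in U N by case: r => // r _; apply: subvP.
  have ij_gt0 : (0 < i - j)%N by rewrite subn_gt0.
  rewrite rpredD ?rpredZ //.
    by apply: (KU' (0 + (i - j))%N); rewrite // gEK // KP hv addr0.
  have /memv_sumP[f fK ->] := yU; rewrite linear_sum rpred_sum // => r _.
  by apply: (KU' (r.+1 + (i - j))%N); rewrite ?gEK ?fK.
have [Z [vZ stZ minZ]] := hw_generated vH.
have Zf : Z = fullv.
  case: (irrM Z) => //; first exact: subvf.
  by move=> Z0; move: vZ v_neq0; rewrite Z0 memv0 => ->.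
have Uf x : x \in (<[v]> + U N)%VS.
  have : x \in Z by rewrite Zf memvf.
  apply: subvP; apply: minZ; first by rewrite memvE addvSl.
  apply: subv_trans (addvSr _ _); apply/subv_sumP => -[i j] /= ji.
  by apply/subvP => _ /memv_imgP[y /(lowU _ _ _ ji) yU ->].
have lfU : (lowered (fullv : {vspace M}) <= U N)%VS.
  apply/subv_sumP => -[i j] /= ji; apply/subvP => _ /memv_imgP[y _ ->].
  exact: lowU.
apply/negP => /(subvP lfU) vU.
(* The product of the h - (c + s) for s = 1, .., r. For r = N it kills [U N], but it multiplies [v]
   by a product of nonzero integers, so [v] is not in [U N]. *)
pose fix P r : 'End(M) :=
  if r is r'.+1 then ((h - (c + r'.+1%:R) *: \1%VF) \o P r')%VF else \1%VF.
have PE a r x : h x = a *: x -> P r x = (\prod_(s < r) (a - (c + s.+1%:R))) *: x.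
  move=> hx; elim: r => [|r IHr]; first by rewrite big_ord0 scale1r id_lfunE.
  rewrite comp_lfunE IHr linearZ /= sub_lfunE scale_lfunE id_lfunE hx -scalerBl.
  by rewrite scalerA big_ord_recr.
have : P N v = 0.
  have /memv_sumP[f fK ->] := vU; rewrite linear_sum big1 // => r _ /=.
  rewrite (PE (c + r.+1%:R)) => [|]; last by apply/eqP; rewrite -KP fK.
  by rewrite (bigD1 r) //= subrr mul0r scale0r.
move/eqP; rewrite (PE c) // scaler_eq0 (negPf v_neq0) orbF.
apply/negP/prodf_neq0 => s _.
by rewrite opprD addrA subrr sub0r oppr_eq0 pnatr_eq0.
Qed.

(** In the presence of a form, [v] is orthogonal to all lowered vectors but not to itself. *)
Lemma form_notin_lowered V B (HB : @contravariant_form F n V B) mu (v : V) :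
  v != 0 -> v \in hwspace V mu -> v \notin lowered (fullv : {vspace V}).
Proof.
move=> v_neq0 /hwspaceP[up _]; apply: contra v_neq0 => vL.
by rewrite -(cform_eq0 HB) (cform_lowered HB up vL).
Qed.

(** Transferring [v] to [x] gives a map defined on all of [L], since its domain is stable and
    nonzero. As in Schur's lemma, irreducibility of [L] and [U] makes it injective with image
    [U]. *)
Lemma hw_sub_iso (L M : glrep F n) B (HB : @contravariant_form F n M B) mu
    (v : L) (U : {vspace M}) (x : M) :
  irreducible L -> v != 0 -> v \in hwspace L mu -> irreducible_sub U ->
  x != 0 -> x \in U -> x \in hwspace M mu -> sub_iso L U.
Proof.
move=> irrL v_neq0 vH [stU U0 irrU] x_neq0 xU xH; have [_ _ subL] := irrL.
have [V1 [f [stV1 vV1 _ fv f_gE]]] := hw_transfer HB vH xH (hw_notin_lowered irrL v_neq0 vH).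
have V1E : V1 = fullv.
  case: (subL V1) => //; first exact: subvf.
  by move=> V10; move: vV1 v_neq0; rewrite V10 memv0 => ->.
have ef : equivariant f by apply/equivariantP => i j y; rewrite f_gE ?V1E ?memvf.
exists f; split=> //.
  case: (subL (lker f)) => //; first exact: subvf.
    apply/stableP => i j y; rewrite !memv_ker f_gE ?V1E ?memvf // => /eqP ->.
    by rewrite linear0.
  move=> kf; move: x_neq0; rewrite -fv.
  have : v \in lker f by rewrite kf memvf.
  by rewrite memv_ker => ->.
have stP : stable (f @^-1: U)%VS.
  apply/stableP => i j y; rewrite -!memv_preim f_gE ?V1E ?memvf //.
  exact: (stableP U).1.
have fU : (limg f <= U)%VS.
  apply/subvP => _ /memv_imgP[y _ ->]; rewrite memv_preim.
  case: (subL _ (subvf _) stP) => [P0|->]; rewrite ?memvf //.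
  have : v \in (f @^-1: U)%VS by rewrite -memv_preim fv.
  by rewrite P0 memv0 (negPf v_neq0).
have stI : stable (limg f).
  apply/stableP => i j _ /memv_imgP[y _ ->].
  by rewrite -f_gE ?V1E ?memvf // memv_img ?memvf.
case: (irrU (limg f) fU stI) => // f0; move: x_neq0.
by rewrite -fv -memv0 -f0 memv_img ?memvf.
Qed.

Lemma hwvP (M : glrep F n) (la : 'I_n -> nat) (v : M) :
  highest_weight_vector la v <-> v != 0 /\ v \in hwspace M (fun i => (la i)%:Z).
Proof.
split=> [[v0 up wt] | [v0 /hwspaceP[up wt]]]; last by split=> //; exact/eqP.
by split; [exact/eqP | exact/hwspaceP].
Qed.

(** In any decomposition, a summand isomorphic to [L] contributes exactly one dimension to the
    highest weight space, and any other summand contributes none. *)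
Theorem has_multiplicity_hwspace (L M : glrep F n) B la :
    @contravariant_form F n M B -> is_irrep_of_highest_weight L la ->
  has_multiplicity L M (\dim (hwspace M (fun i => (la i)%:Z))).
Proof.
move=> HB [irrL [v /hwvP[v_neq0 vH]]]; set mu := fun i => _.
split.
  have stf : stable (fullv : {vspace M}) by move=> A; exact: subvf.
  by have [r [V [irrV dirV sumV]]] := semisimple HB stf; exists r, V.
move=> r U decU; have [irrU _ _] := decU.
rewrite (hw_dim_sum mu decU) -sum1dep_card big_mkcond; apply: eq_bigr => s _.
case: ifP => [/asboolP[f [ef kf fU]] | /asboolP niso].
  apply/eqP; rewrite eqn_leq (hw_irreducible_dim HB) // andbT lt0n dimv_eq0.
  apply/eqP => H0; have : f v \in (U s :&: hwspace M mu)%VS.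
    by rewrite memv_cap -fU memv_img ?memvf //= (equivariant_hw ef).
  rewrite H0 memv0 -memv_ker kf memv0; exact/negP.
apply/esym/eqP; rewrite dimv_eq0; apply/eqP/vspaceP => x; rewrite memv0.
apply/idP/eqP => [/memv_capP[xU xH] | ->]; last exact: mem0v.
apply/eqP/negPn/negP => x_neq0; apply: niso.
exact: (hw_sub_iso HB irrL v_neq0 vH (irrU s) x_neq0 xU xH).
Qed.

End Transfer.

(** * Annihilation operators on the exterior algebra and on its tensor products *)

Section Fermions.
Variables (F : fieldType) (n : nat).
Local Notation A := (exterior_rep F n).
Local Notation ext := {ffun {set 'I_n} -> F^o}.
Implicit Types (S T : {set 'I_n}) (i j p q : 'I_n).

Lemma gE_ext p q (x : A) : gE A p q x = cr F p (an F q x).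
Proof.
rewrite /gE /= ext_act_cran (bigD1 p) //= (bigD1 q) //= !mxE !eqxx scale1r.
rewrite big1 ?addr0 ?big1 ?addr0 // => i.
  move=> /negPf ip; rewrite big1 // => s _.
  by rewrite mxE ip scale0r.
by move=> /negPf iq; rewrite mxE iq andbF scale0r.
Qed.

(** The annihilation operators transform under gl_n like the dual basis. *)
Lemma gE_an p q i (x : A) :
  gE A p q (an F i x) = an F i (gE A p q x) - (p == i)%:R *: an F q x.
Proof.
rewrite !gE_ext car_an_cr eq_sym car_an_an linearN /=.
by rewrite addrC addrA addNr add0r.
Qed.

Fact parity_linear : linear (fun x : ext => [ffun S : {set 'I_n} => (-1) ^+ #|S| * x S] : ext).
Proof.
move=> a x y; apply/ffunP => S; rewrite !ffunE mulrDr; congr (_ + _).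
exact: mulrCA.
Qed.

(** The sign of the degree. It anticommutes with [cr] and [an], and provides the Koszul sign needed
    for annihilation operators on different tensor factors to anticommute. *)
Definition parity : 'End(A) := sval (linear_lfun parity_linear).

Lemma parityE (x : A) S : parity x S = (-1) ^+ #|S| * x S.
Proof. by rewrite /parity; case: linear_lfun => g /= ->; rewrite ffunE. Qed.

Lemma parity_an i (x : A) : parity (an F i x) = - an F i (parity x).
Proof.
apply/ffunP => S; rewrite ffunE parityE !anE parityE.
case: ifP => [_ | /negbT iS]; first by rewrite mulr0 oppr0.
by rewrite cardsU1 iS exprS !mulNr mul1r mulrN opprK mulrCA.
Qed.

Lemma parity_cr i (x : A) : parity (cr F i x) = - cr F i (parity x).
Proof.
apply/ffunP => S; rewrite ffunE parityE !crE parityE.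
case: ifP => [iS | _]; last by rewrite mulr0 oppr0.
by rewrite [in LHS](cardsD1 i) iS exprS !mulNr mul1r mulrCA.
Qed.

Lemma gE_parity p q (x : A) : gE A p q (parity x) = parity (gE A p q x).
Proof. by rewrite !gE_ext parity_cr parity_an linearN opprK. Qed.

Fact ecoef_subproof S : linear (fun x : A => x S : line F).
Proof. by move=> a x y; rewrite !ffunE. Qed.

Definition ecoef S : 'Hom(A, line F) := sval (linear_lfun (ecoef_subproof S)).

Lemma ecoefE S (x : A) : ecoef S x = x S.
Proof. by rewrite /ecoef; case: linear_lfun => g /= ->. Qed.

Lemma ext_sum (x : A) : x = \sum_S x S *: ext_basis F S.
Proof.
apply/ffunP => T; rewrite sum_ffunE (bigD1 T) //= big1 ?addr0.
  by rewrite !ffunE eqxx [RHS]mulr1.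
by move=> S neS; rewrite !ffunE eq_sym (negPf neS) scaler0.
Qed.

Section TensorCoordinates.
Variable W : glrep F n.
Local Notation T_ := (tensor_rep A W).

(* [crd S X] is the component of [X] along [e_S (x) W]. *)
Fact crd_subproof S : linear (fun X : T_ => X (ecoef S) : W).
Proof. by move=> a X Y; rewrite add_lfunE scale_lfunE. Qed.

Definition crd S : 'Hom(T_, W) := sval (linear_lfun (crd_subproof S)).

Lemma crdE S (X : T_) : crd S X = X (ecoef S).
Proof. by rewrite /crd; case: linear_lfun => g /= ->. Qed.

Lemma crd_inj (X Y : T_) : (forall S, crd S X = crd S Y) -> X = Y.
Proof.
move=> XY; apply/lfunP => phi.
have -> : phi = \sum_S phi (ext_basis F S) *: ecoef S.
  apply/lfunP => x; rewrite sum_lfunE [in LHS](ext_sum x) linear_sum.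
  by apply: eq_bigr => S _; rewrite linearZ scale_lfunE ecoefE; exact: mulrC.
by rewrite !linear_sum; apply: eq_bigr => S _; rewrite !linearZ /= -!crdE XY.
Qed.

Definition of_crd (w : {set 'I_n} -> W) : T_ :=
  \sum_S @pure_tensor F n A W (ext_basis F S) (w S).

Lemma of_crdK w S : crd S (of_crd w) = w S.
Proof.
rewrite linear_sum (bigD1 S) //= big1 => [|T /negPf TS]; rewrite crdE pure_tensorE ecoefE ffunE.
  by rewrite eqxx scale1r addr0.
by rewrite eq_sym TS scale0r.
Qed.

(** On the first factor, E_pq sends e_T to a multiple of e_S only for T = (S \ p) + q. The case p =
    q is included: then T = S and the two signs cancel. *)
Lemma crd_gE S p q (X : T_) :
  crd S (gE T_ p q X) = gE W p q (crd S X) +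
   (if (p \in S) && (q \notin S :\ p)
    then (ksign F p S * ksign F q (S :\ p)) *: crd (q |: (S :\ p)) X else 0).
Proof.
rewrite !crdE /gE tensor_actE addrC; congr (_ + _).
pose T := q |: (S :\ p).
have -> : (ecoef S \o gE A p q)%VF =
    (if (p \in S) && (q \notin S :\ p) then ksign F p S * ksign F q (S :\ p) else 0)
      *: ecoef T.
  apply/lfunP => x; rewrite comp_lfunE scale_lfunE !ecoefE gE_ext crE anE.
  by case: (p \in S); case: (q \in S :\ p) => /=; rewrite ?mulr0 ?scale0r //= mulrA.
by rewrite linearZ /=; case: ifP; rewrite ?scale0r.
Qed.

Fact ann_step_fun_subproof (a : 'End(W)) i (X : T_) :
  linear (fun psi : 'Hom(A, line F) =>
            X (psi \o an F i)%VF + a (X (psi \o parity)%VF)).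
Proof.
move=> c f g; rewrite !comp_lfunDl -!comp_lfunZl !linearP /=.
by rewrite scalerDr addrACA.
Qed.

Fact ann_step_subproof (a : 'End(W)) i :
  linear (fun X : T_ => sval (linear_lfun (ann_step_fun_subproof a i X)) : T_).
Proof.
move=> c X Y; apply/lfunP => psi; do 3?case: linear_lfun => ? /=.
move=> E1 E2 E3; rewrite add_lfunE scale_lfunE E1 E2 E3.
by rewrite !add_lfunE !scale_lfunE linearP scalerDr addrACA.
Qed.

(* [an i (x) 1 + parity (x) a] *)
Definition ann_step (a : 'End(W)) i : 'End(T_) := sval (linear_lfun (ann_step_subproof a i)).

Lemma ann_stepE (a : 'End(W)) i (X : T_) psi :
  ann_step a i X psi = X (psi \o an F i)%VF + a (X (psi \o parity)%VF).
Proof. by rewrite /ann_step; case: linear_lfun => g /= ->; case: linear_lfun => ? /= ->. Qed.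

Lemma crd_ann_step (a : 'End(W)) i (X : T_) S :
  crd S (ann_step a i X) =
  (if i \in S then 0 else ksign F i S *: crd (i |: S) X) + (-1) ^+ #|S| *: a (crd S X).
Proof.
rewrite !crdE ann_stepE; congr (_ + _).
  have -> : (ecoef S \o an F i)%VF = (if i \in S then 0 else ksign F i S) *: ecoef (i |: S).
    apply/lfunP => x; rewrite comp_lfunE scale_lfunE !ecoefE anE.
    by case: ifP => _; rewrite ?scale0r.
  by rewrite linearZ /=; case: ifP => _; rewrite ?scale0r.
have -> : (ecoef S \o parity)%VF = (-1) ^+ #|S| *: ecoef S.
  by apply/lfunP => x; rewrite comp_lfunE scale_lfunE !ecoefE parityE.
by rewrite !linearZ.
Qed.

(** The mixed terms cancel because [parity] anticommutes with [an]. *)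
Lemma ann_step_anti (a b : 'End(W)) i j :
  (forall y, a (b y) = - b (a y)) ->
  forall X, ann_step a i (ann_step b j X) = - ann_step b j (ann_step a i X).
Proof.
move=> ab X; apply/lfunP => psi; rewrite opp_lfunE !ann_stepE !linearD /= ab.
have anan : ((psi \o an F i) \o an F j = - ((psi \o an F j) \o an F i))%VF.
  by apply/lfunP => x; rewrite opp_lfunE !comp_lfunE /= car_an_an linearN.
have anpar k : ((psi \o parity) \o an F k = - ((psi \o an F k) \o parity))%VF.
  by apply/lfunP => x; rewrite opp_lfunE !comp_lfunE /= parity_an linearN.
rewrite anan !anpar !linearN /= !opprK.
by rewrite [LHS](AC (2*2) ((1*3)*(2*4))).
Qed.

(** Here [a] and [b] stand for the annihilation operators of indices [i] and [q] on [W]. *)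
Lemma ann_step_gE (a b : 'End(W)) p q i :
  (forall y, gE W p q (a y) = a (gE W p q y) - (p == i)%:R *: b y) ->
  forall X, gE T_ p q (ann_step a i X) =
    ann_step a i (gE T_ p q X) - (p == i)%:R *: ann_step b q X.
Proof.
move=> aE X; apply/lfunP => psi; rewrite sub_lfunE scale_lfunE.
have gEE (Y : T_) phi : gE T_ p q Y phi = Y (phi \o gE A p q)%VF + gE W p q (Y phi).
  exact: tensor_actE.
rewrite gEE !ann_stepE !gEE !linearD /= aE.
have -> : ((psi \o gE A p q) \o an F i =
    (psi \o an F i) \o gE A p q - (p == i)%:R *: (psi \o an F q))%VF.
  apply/lfunP => x; rewrite sub_lfunE scale_lfunE !comp_lfunE /=.
  by rewrite gE_an linearB linearZ.
have -> : ((psi \o gE A p q) \o parity = (psi \o parity) \o gE A p q)%VF.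
  by apply/lfunP => x; rewrite !comp_lfunE /= gE_parity.
rewrite linearB linearZ /= -/(gE A p q).
by rewrite [LHS](AC (3*(1*2)) (((1*4)*(3*5))*(2*6))).
Qed.

End TensorCoordinates.

Arguments crd {W} S.

End Fermions.

Arguments crd {F n W} S.
Arguments ecoef {F n} S.

(** * The contravariant form on a tensor product with the exterior algebra *)

Section TensorForm.
Variables (F : numClosedFieldType) (n : nat).
Local Notation A := (exterior_rep F n).
Implicit Types (S T : {set 'I_n}) (i j p q : 'I_n).

(** The product of [B] with the form for which the e_S are orthonormal. *)
Definition tensor_form (W : glrep F n) (B : W -> W -> F) (X Y : tensor_rep A W) : F :=
  \sum_(S : {set 'I_n}) B (crd S X) (crd S Y).

(** The right-hand side is symmetric in [i] and [j], which allows E_ij and E_ji to be exchanged. *)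
Lemma sum_move i j (h : {set 'I_n} -> F) :
  \sum_(S : {set 'I_n}) (if (i \in S) && (j \notin S :\ i) then h (S :\ i) else 0) =
  \sum_(S : {set 'I_n} | (i \notin S) && (j \notin S)) h S.
Proof.
rewrite -big_mkcond (reindex_onto (fun S => i |: S) (fun S => S :\ i)) /=; last first.
  by move=> S /andP[iS _]; rewrite setD1K.
have cE S : (i \in i |: S) && (j \notin (i |: S) :\ i) && ((i |: S) :\ i == S) =
    (i \notin S) && (j \notin S).
  rewrite setU11 /=; case: (boolP (i \in S)) => iS /=; last by rewrite setU1K // eqxx andbT.
  apply/negbTE/nandP; right; apply/eqP => SE.
  by move: iS; rewrite -SE setD11.
by apply: eq_big => S; rewrite cE // => /andP[iS _]; rewrite setU1K.
Qed.

Lemma ksignUid i S : i \notin S -> ksign F i (i |: S) = ksign F i S.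
Proof. by move=> iS; rewrite ksignU // ltnn mul1r. Qed.

Lemma tensor_formP (W : glrep F n) B : @contravariant_form F n W B -> contravariant_form (@tensor_form W B).
Proof.
move=> HB; split.
- move=> a X Y Z; rewrite /tensor_form mulr_sumr -big_split; apply: eq_bigr => S _ /=.
  by rewrite linearP (cformDZ HB).
- move=> X Y; rewrite /tensor_form rmorph_sum; apply: eq_bigr => S _.
  by rewrite (cformC HB).
- move=> X X_neq0.
  have ge0 S : 0 <= B (crd S X) (crd S X).
    by have [->|/(cform_gt0 HB)/ltW//] := eqVneq (crd S X) 0; rewrite (cform0 HB).
  rewrite lt_neqAle sumr_ge0 // andbT eq_sym; apply: contra X_neq0 => /eqP X0.
  apply/eqP/crd_inj => S; rewrite linear0; apply/eqP; rewrite -(cform_eq0 HB).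
  by move/eqP: X0; rewrite psumr_eq0 // => /allP/(_ S); rewrite mem_index_enum => /(_ isT).
- move=> p q X Y; rewrite /tensor_form.
  under eq_bigr do rewrite crd_gE (cformD HB).
  under [RHS]eq_bigr do rewrite crd_gE (cformDr HB).
  rewrite !big_split; congr (_ + _) => /=.
    by apply: eq_bigr => S _; rewrite (cform_gE HB).
  (* The contribution of E_pq e_(S + q) = +-e_(S + p), for [S] containing neither index; both sides
     of the adjunction are the sum of these. *)
  pose h S := (ksign F p S * ksign F q S) * B (crd (q |: S) X) (crd (p |: S) Y).
  transitivity (\sum_(S : {set 'I_n}) if (p \in S) && (q \notin S :\ p) then h (S :\ p) else 0).
    apply: eq_bigr => S _; case: ifP => [/andP[pS qS] | _]; last by rewrite (cform0 HB).
    by rewrite (cformZ HB) /h setD1K // [ksign F p (S :\ p)]ksignD // ltnn mul1r.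
  rewrite sum_move; transitivity (\sum_(S : {set 'I_n} | (q \notin S) && (p \notin S)) h S).
    by apply: eq_bigl => S; rewrite andbC.
  rewrite -sum_move; apply: eq_bigr => S _; case: ifP => [/andP[pS qS] | _]; last by rewrite (cformr0 HB).
  rewrite (cformZr HB) /h setD1K // [ksign F q (S :\ q)]ksignD // ltnn mul1r rmorphM.
  by rewrite /ksign !rmorphXn !rmorphN1 [_ * _ ^+ _]mulrC.
Qed.

End TensorForm.

(** * Tensor powers: annihilation operators, the coaction and explicit highest weight vectors *)

Section TensorPower.
Variables (F : numClosedFieldType) (n : nat).
Local Notation A := (exterior_rep F n).
Local Notation M l := (tensor_power A l).
Implicit Types (S T : {set 'I_n}) (i j p q : 'I_n).

Lemma gE_trivial i j (x : trivial_rep F n) : gE (trivial_rep F n) i j x = 0.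
Proof. exact: zero_lfunE. Qed.

Fixpoint power_form l : M l -> M l -> F :=
  match l return M l -> M l -> F with
  | 0 => fun x y : F => x * y^*
  | l'.+1 => tensor_form (power_form (l := l'))
  end.

Lemma power_formS l (X Y : M l.+1) :
  power_form X Y = tensor_form (power_form (l := l)) X Y.
Proof. by []. Qed.

Arguments power_form : simpl never.

Lemma power_formP l : contravariant_form (power_form (l := l)).
Proof.
elim: l => [|l IHl]; last exact: tensor_formP.
rewrite /power_form; split=> /= [a x y z | x y | x x0 | i j x y].
- by rewrite mulrDl mulrA.
- by rewrite rmorphM /= conjCK mulrC.
- by rewrite mul_conjC_gt0.
- rewrite (gE_trivial i j x) (gE_trivial j i y).
  have -> : (0 : trivial_rep F n)^* = 0 :> F := conjC0 F.
  by rewrite [LHS](mul0r (y^* : F)) [RHS](mulr0 (x : F)).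
Qed.

(** The sum over the [l] factors of the contraction of index [i] in that factor, with [parity]
    applied to all earlier factors. *)
Fixpoint ann l i : 'End(M l) :=
  match l return 'End(M l) with
  | 0 => 0
  | l'.+1 => ann_step (ann l' i) i
  end.

Lemma ann_anti l i j (y : M l) : ann l i (ann l j y) = - ann l j (ann l i y).
Proof.
elim: l y => [|l IHl] y; last exact: ann_step_anti.
by rewrite /= !zero_lfunE oppr0.
Qed.

Lemma ann_nil l i (y : M l) : ann l i (ann l i y) = 0.
Proof.
apply/eqP; have /eqP := ann_anti i i y.
by rewrite -addr_eq0 -mulr2n -scaler_nat scaler_eq0 pnatr_eq0.
Qed.

Lemma ann_gE l p q i (y : M l) :
  gE (M l) p q (ann l i y) = ann l i (gE (M l) p q y) - (p == i)%:R *: ann l q y.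
Proof.
elim: l y => [|l IHl] y; last exact: (ann_step_gE IHl).
by rewrite [LHS](gE_trivial p q (ann 0 i y)) !zero_lfunE scaler0 subr0.
Qed.

Definition anns l (s : seq 'I_n) (y : M l) : M l := foldr (ann l) y s.

Definition annS l T (y : M l) : M l := anns (enum T) y.

Fact annsP l s : linear (anns (l := l) s).
Proof.
move=> a x y; elim: s => //= i s IHs.
by rewrite IHs linearP.
Qed.

Lemma annsZ l s a (y : M l) : anns s (a *: y) = a *: anns s y.
Proof. by have [g gP] := linear_lfun (annsP (l := l) s); rewrite -!gP linearZ. Qed.

Lemma anns_anti l i s (y : M l) : ann l i (anns s y) = (-1) ^+ size s *: anns s (ann l i y).
Proof.
elim: s => [|j s IHs] /=; first by rewrite scale1r.
by rewrite ann_anti IHs linearZ exprS mulN1r scaleNr.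
Qed.

(** Operators are multiplied in increasing order of index; bringing index [i] to its place passes
    the smaller elements of [T], whose number gives [ksign F i T]. *)
Lemma annS_ksign l i T (y : M l) : i \in T ->
  ksign F i T *: ann l i (annS (T :\ i) y) = annS T y.
Proof.
move=> iT; rewrite /annS.
have [p1 [p2 [eqp p1i p2i]]] : exists p1 p2 : seq 'I_n, [/\ enum 'I_n = p1 ++ i :: p2,
    {in p1, forall t : 'I_n, (t < i)%N} & {in p2, forall t : 'I_n, (i < t)%N}].
  exists (take i (enum 'I_n)), (drop i.+1 (enum 'I_n)).
  have sz : size (enum 'I_n) = n := size_enum_ord n.
  split.
  - by rewrite -{2}(nth_ord_enum i i) -drop_nth ?sz // cat_take_drop.
  - move=> t /(map_f val); rewrite map_take val_enum_ord take_iota mem_iota /= add0n.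
    by move/leq_trans; apply; exact: geq_minl.
  - move=> t /(map_f val); rewrite map_drop val_enum_ord drop_iota mem_iota add0n.
    by case/andP.
have eD : {in p1 ++ p2, forall t, (t \in T :\ i) = (t \in T)}.
  move=> t; rewrite mem_cat !inE -val_eqE /= => /orP[/p1i | /p2i] ti.
    by rewrite (ltn_eqF ti).
  by rewrite (gtn_eqF ti).
have eE (U : {set 'I_n}) : enum U = [seq t <- enum 'I_n | t \in U] by rewrite enumT.
rewrite !eE eqp !filter_cat /= iT setD11.
have eq1 : [seq t <- p1 | t \in T :\ i] = [seq t <- p1 | t \in T].
  by apply: eq_in_filter => t tp; rewrite eD // mem_cat tp.
have eq2 : [seq t <- p2 | t \in T :\ i] = [seq t <- p2 | t \in T].
  by apply: eq_in_filter => t tp; rewrite eD // mem_cat tp orbT.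
rewrite eq1 eq2 /anns !foldr_cat /= -/(anns _ _) -/(anns _ _).
rewrite anns_anti scalerA -[X in X *: _]/(ksign F i T * _).
have -> : ksign F i T = (-1) ^+ size [seq t <- p1 | t \in T].
  rewrite /ksign; congr (_ ^+ _).
  have -> : [set t in T | (t < i)%N] = [set t in [seq t <- p1 | t \in T]].
    apply/setP => t; rewrite !inE mem_filter; case: (boolP (t \in T)) => //= tT.
    have : t \in p1 ++ i :: p2 by rewrite -eqp mem_enum.
    rewrite mem_cat inE; case: (boolP (t \in p1)) => [/p1i -> // | _ /=].
    by case/orP=> [/eqP -> | /p2i ti]; rewrite ?ltnn // ltnNge ltnW.
  rewrite cardsE; apply/card_uniqP/filter_uniq.
  by have := enum_uniq 'I_n; rewrite eqp cat_uniq => /andP[].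
by rewrite -expr2 sqrr_sign scale1r.
Qed.

(** The commutator of E_pq with an annihilation operator of index [i] vanishes unless i = p. *)
Lemma annS_gE_notin l p q T (y : M l) : p \notin T ->
  annS T (gE (M l) p q y) = gE (M l) p q (annS T y).
Proof.
move=> pT; have : {in enum T, forall i, p != i}.
  by move=> i; rewrite mem_enum; apply: contraTneq => <-.
rewrite /annS; elim: (enum T) => //= i s IHs ps.
rewrite IHs ?ann_gE => [|j js]; last by rewrite ps // inE js orbT.
by rewrite (negPf (ps i (mem_head _ _))) scale0r subr0.
Qed.

Lemma annS_in l q T (y : M l) : q \in T -> ann l q (annS T y) = 0.
Proof. by move=> qT; rewrite -(annS_ksign y qT) linearZ /= ann_nil scaler0. Qed.

(* The exponential of the invariant operator [\sum_i cr i (x) ann i], applied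
   to [1 (x) y]. *)
Definition coaction l (y : M l) : tensor_rep A (M l) := of_crd (fun T => annS T y).

(** For p in S, write a_S as +-a_p a_(S \ p). Commuting E_pq past a_p leaves the term -+a_q a_(S \
    p), which cancels the contribution of e_(S \ p + q); if q is in S \ p, both are zero. *)
Lemma coaction_gE l p q (y : M l) :
  gE (tensor_rep A (M l)) p q (coaction y) = coaction (gE (M l) p q y).
Proof.
apply: crd_inj => S; rewrite crd_gE !of_crdK.
case: (boolP (p \in S)) => pS /=; last by rewrite addr0 annS_gE_notin.
have E z : annS S z = ksign F p S *: ann l p (annS (S :\ p) z) by rewrite annS_ksign.
rewrite (E y) (E (gE _ _ _ y)) linearZ /= ann_gE eqxx scale1r scalerBr.
rewrite annS_gE_notin ?setD11 //; case: ifP => [qS | /negbFE qS].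
  rewrite -(annS_ksign y (setU11 q (S :\ p))) setU1K // scalerA -mulrA.
  by rewrite ksignUid // ksign_sq mulr1 subrK.
by rewrite annS_in // scaler0 subr0 addr0.
Qed.

Lemma coaction_hw l mu (y : M l) : y \in hwspace (M l) mu ->
  coaction y \in hwspace (tensor_rep A (M l)) mu.
Proof.
move=> /hwspaceP[up wt]; apply/hwspaceP; split=> [i j ij | i]; rewrite coaction_gE.
  rewrite up //; apply: crd_inj => S; rewrite of_crdK linear0.
  by have := annsZ (enum S) 0 y; rewrite !scale0r.
by rewrite wt; apply: crd_inj => S; rewrite linearZ /= !of_crdK /annS annsZ.
Qed.

Definition supp (la : 'I_n -> nat) : {set 'I_n} := [set i | la i != 0%N].

(** Counting from 0, factor number c is e_S for S = {i : la i > c}, which for a partition is column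
    c of the Young diagram. *)
Fixpoint hwvec l (la : 'I_n -> nat) : M l :=
  match l return M l with
  | 0 => (1 : F)
  | l'.+1 => @pure_tensor F n A (M l') (ext_basis F (supp la)) (hwvec l' (fun i => (la i).-1))
  end.

Arguments hwvec : simpl never.

Lemma hwvecS l la : hwvec l.+1 la =
  @pure_tensor F n A (M l) (ext_basis F (supp la)) (hwvec l (fun i => (la i).-1)).
Proof. by []. Qed.

Lemma crd_pure (W : glrep F n) P (w : W) S :
  crd S (@pure_tensor F n A W (ext_basis F P) w) = (S == P)%:R *: w.
Proof. by rewrite crdE pure_tensorE ecoefE ffunE. Qed.

Lemma hwvec_hw l la :
  (forall i j, (i <= j)%N -> (la j <= la i)%N) -> (forall i, (la i <= l)%N) ->
  hwvec l la \in hwspace (M l) (fun i => (la i)%:Z).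
Proof.
elim: l la => [|l IHl] la dom bnd.
  apply/hwspaceP; split=> [i j _ | i]; first by rewrite gE_trivial.
  by rewrite gE_trivial (eqP (_ : la i == 0%N)) ?scale0r // -leqn0.
have /hwspaceP[up wt] : hwvec l (fun i => (la i).-1) \in hwspace (M l) (fun i => (la i).-1%:Z).
  apply: IHl => [i j /dom le_ji | i]; last by have := bnd i; lia.
  by lia.
rewrite hwvecS; move: (hwvec l _) up wt => y up wt.
apply/hwspaceP; split=> [i j ij | i]; apply: crd_inj => S; rewrite crd_gE !crd_pure.
  rewrite linearZ /= up // scaler0 add0r linear0.
  case: ifP => // /andP[iS jS].
  (* Otherwise the support of [la] would contain [j] but not [i], although i < j and [la] is
     dominant. *)
  rewrite (_ : (_ == _) = false) ?scale0r ?scaler0 //.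
  apply/negP => /eqP/setP E; have := E j; rewrite !inE eqxx /= => /esym la_j.
  have := E i; rewrite !inE eqxx /= orbF => /esym.
  rewrite -val_eqE (ltn_eqF ij) /=; have := dom i j (ltnW ij); move/eqP: la_j; lia.
rewrite !linearZ /= ?crd_pure setD11 andbT wt.
case: (boolP (i \in S)) => iS.
  rewrite setD1K // ?crd_pure ksignD // ltnn mul1r ksign_sq scale1r.
  have [SE|_] := eqVneq S (supp la); last by rewrite !scale0r scaler0 addr0.
  move: iS; rewrite SE inE => la_i; rewrite !scale1r -{2}[y]scale1r -scalerDl.
  congr (_ *: _); rewrite -[X in _ + X]/(1%:~R) -rmorphD /=; congr (_%:~R).
  by move: la_i; lia.
have [SE|_] := eqVneq S (supp la); last by rewrite !scale0r scaler0 addr0.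
by move: iS; rewrite SE inE negbK => /eqP ->; rewrite !scale0r !scaler0 addr0.
Qed.

(** To reach e_T from e_P, exactly the indices in P \ T have to act on the first factor; the other
    operators of [s] act on [y]. The constant is a sign, of which only the nonvanishing is kept. *)
Lemma crd_anns l s P T (y : M l) : uniq s ->
  exists2 c : F, c != 0 &
    crd T (@anns l.+1 s (@pure_tensor F n A (M l) (ext_basis F P) y)) =
    (if (T \subset P) && [forall i in P :\: T, i \in s] then c else 0)
      *: anns [seq i <- s | i \notin P :\: T] y.
Proof.
elim: s T => [|i s IHs] T /= => [_ | /andP[iNs s_uniq]].
  exists 1; rewrite ?oner_eq0 // crd_pure; congr (_ *: _).
  have -> : (T == P) = (T \subset P) && [forall i in P :\: T, i \in [::]].
    rewrite eqEsubset; congr (_ && _).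
    apply/subsetP/forallP => [PT i | H i iP].
      by apply/implyP; rewrite inE => /andP[/negP iT iP]; case: iT; exact: PT.
    by have := H i; rewrite !inE iP andbT implybF negbK.
  by case: ifP.
rewrite crd_ann_step.
have [c1 c1_neq0 E1] := IHs T s_uniq; have [c2 c2_neq0 E2] := IHs (i |: T) s_uniq.
rewrite E1 E2; have [iD | iD] := boolP (i \in P :\: T).
  have /setDP[iP iT] := iD; exists (ksign F i T * c2).
    by rewrite mulf_neq0 // /ksign signr_eq0.
  rewrite (negPf iT) subUset sub1set iP /=.
  have -> : [forall j in P :\: T, j \in s] = false.
    by apply/negP => /forallP/(_ i); rewrite iD (negPf iNs).
  rewrite andbF scale0r linear0 scaler0 addr0.
  have -> : [forall j in P :\: (i |: T), j \in s] = [forall j in P :\: T, j \in i :: s].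
    apply: eq_forallb => j; rewrite !inE.
    have [->|ji] := eqVneq j i; first by rewrite ?eqxx /= implybT.
    by [].
  rewrite scalerA; congr (_ *: _); first by case: ifP; rewrite ?mulr0.
  congr (anns _ y); apply: eq_in_filter => j js; rewrite !inE.
  by have [ji|//] := eqVneq j i; move: iNs; rewrite -ji js.
exists ((-1) ^+ #|T| * c1); first by rewrite mulf_neq0 // signr_eq0.
have -> : (if i \in T then 0 else ksign F i T *: (
   (if (i |: T \subset P) && [forall j in P :\: (i |: T), j \in s] then c2 else 0)
      *: anns [seq j <- s | j \notin P :\: (i |: T)] y)) = 0.
  case: ifP => // /negbT iT; move: iD; rewrite inE iT /= => iP.
  by rewrite subUset sub1set (negPf iP) /= scale0r scaler0.
rewrite add0r /= linearZ scalerA /=; congr (_ *: _).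
have -> : [forall j in P :\: T, j \in i :: s] = [forall j in P :\: T, j \in s].
  apply: eq_forallb => j; rewrite in_cons.
  by have [->|//] := eqVneq j i; rewrite (negPf iD).
by case: ifP; rewrite ?mulr0.
Qed.

(** Only e_T with T = supp mu in the first factor pairs nontrivially. Reaching it uses up the [i]
    with la i = 1 and mu i = 0; the remaining operators relate the two weights with their first
    columns removed, and induction applies. *)
Lemma anns_hwvec l s (la mu : 'I_n -> nat) : uniq s ->
  (forall i, (la i <= l)%N) -> (forall i, la i = (mu i + (i \in s))%N) ->
  power_form (anns s (hwvec l la)) (hwvec l mu) != 0.
Proof.
elim: l s la mu => [|l IHl] s la mu s_uniq bnd la_mu.
  have -> : s = [::].
    by case: s la_mu {s_uniq} => // i s /(_ i); have := bnd i; rewrite mem_head; lia.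
  by rewrite /power_form /hwvec /= mul1r conjC1 oner_eq0.
have [c c_neq0 E] := crd_anns (supp la) (supp mu) (hwvec l (fun i => (la i).-1)) s_uniq.
rewrite power_formS /tensor_form (bigD1 (supp mu)) //= big1 ?addr0.
  rewrite crd_pure eqxx scale1r E.
  have -> : (supp mu \subset supp la) && [forall i in supp la :\: supp mu, i \in s].
    apply/andP; split; first by apply/subsetP => i; rewrite !inE la_mu; lia.
    apply/forallP => i; rewrite !inE la_mu; apply/implyP.
    by case: (i \in s) => //; lia.
  rewrite /= (cformZ (power_formP l)) mulf_neq0 //; apply: IHl.
  - exact: filter_uniq.
  - by move=> i; have := bnd i; lia.
  - move=> i; rewrite mem_filter !inE; have := la_mu i; case: (i \in s); lia.
by move=> T /negPf Tmu; rewrite crd_pure Tmu scale0r (cformr0 (power_formP l)).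
Qed.

End TensorPower.

(** * Pieri's rule for dimensions of highest weight spaces *)

Lemma dimv_joint_coordinates (K : fieldType) (V W : vectType K) (I : finType)
    (f : I -> 'Hom(V, W)) (U : {vspace V}) (H : I -> {vspace W}) :
  (forall i x, x \in U -> f i x \in H i) ->
  (forall x, x \in U -> (forall i, f i x = 0) -> x = 0) ->
  (forall i h, h \in H i -> exists2 x, x \in U &
     f i x = h /\ forall j, j != i -> f j x = 0) ->
  \dim U = (\sum_i \dim (H i))%N.
Proof.
move=> fH finj fsurj.
(* The kernels are intersected one at a time. By the lifting hypothesis, [f i] still maps the
   current intersection onto [H i], so rank-nullity removes exactly [\dim (H i)]. *)
have E (s : seq I) : uniq s ->
    \dim U = (\dim (U :&: \bigcap_(i <- s) lker (f i))%VS + \sum_(i <- s) \dim (H i))%N.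
  elim: s => [|i s IHs]; first by rewrite !big_nil capvf addn0.
  rewrite [uniq _]/= => /andP[iNs s_uniq]; rewrite (IHs s_uniq) !big_cons.
  rewrite addnA; congr (_ + _)%N; rewrite [(lker _ :&: _)%VS]capvC capvA.
  set U' := (U :&: _)%VS; rewrite -(limg_ker_dim (f i) U'); congr (_ + \dim _)%N.
  apply/eqP; rewrite eqEsubv; apply/andP; split; apply/subvP => y.
    by case/memv_imgP => x /memv_capP[xU _] ->; exact: fH.
  move/fsurj => [x xU [<- fx0]]; apply: memv_img; rewrite memv_cap xU /=.
  rewrite memvE big_seq; elim/big_rec: _ => [|j Z js xZ]; first exact: subvf.
  rewrite subv_cap xZ andbT -memvE memv_ker fx0 //.
  by apply: contraTneq js => ->.
rewrite (E _ (index_enum_uniq I)).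
rewrite (_ : (_ :&: _)%VS = 0%VS) ?dimv0 //.
apply/eqP; rewrite -subv0; apply/subvP => x /memv_capP[xU]; rewrite memvE => /subv_bigcapP xK.
rewrite memv0; apply/eqP/finj => // i; apply/eqP.
by rewrite -memv_ker memvE xK.
Qed.

Section TensorStep.
Variables (F : numClosedFieldType) (n : nat).
Local Notation A := (exterior_rep F n).
Implicit Types (V W : glrep F n) (S T : {set 'I_n}) (i j p q : 'I_n).

(** The map [g] is the transfer of [v] to [w] preceded by the orthogonal projection to its domain.
    Since [v] is orthogonal to lowered vectors, the coefficient of [v] in the projection of [z] is
    BV(z, v) / BV(v, v). *)
Lemma hw_extension V W BV BW (HV : @contravariant_form F n V BV)
    (HW : @contravariant_form F n W BW) mu (v : V) (w : W) :
  v != 0 -> v \in hwspace V mu -> w \in hwspace W mu ->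
  exists2 g : 'Hom(V, W), equivariant g &
    forall z, exists2 t, t \in lowered (fullv : {vspace W}) &
      g z = (BV z v / BV v v) *: w + t.
Proof.
move=> v_neq0 vH wH.
have [V1 [f [stV1 vV1 V1E fv f_gE]]] := hw_transfer HW vH wH (form_notin_lowered HV v_neq0 vH).
exists (f \o orthproj HV V1)%VF.
  apply/equivariantP => i j x; rewrite !comp_lfunE.
  have /equivariantP -> := orthproj_equivariant HV stV1.
  by rewrite f_gE ?orthproj_mem.
move=> z; rewrite comp_lfunE; have pV1 := orthproj_mem HV V1 z.
have /memv_addP[_ /vlineP[c ->] [t tL pE]] := subvP V1E _ pV1.
have Bvv : BV v v != 0 by rewrite (cform_eq0 HV).
have -> : BV z v / BV v v = c.
  rewrite -(orthprojE HV z vV1) pE (cformD HV) (cformZ HV).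
  have -> : BV t v = 0 by apply: (cform_lowered HV _ tL); case/hwspaceP: vH.
  by rewrite addr0 mulfK.
exists (f t); last by rewrite pE linearD linearZ /= fv.
have /memv_sumP[g gN ->] := tL; rewrite linear_sum; apply: memv_sumr => -[i j] /= ji.
have /memv_imgP[y yN ->] := gN (i, j) ji.
by rewrite f_gE // memv_img ?memvf.
Qed.

Lemma tensor_map_hw V W (g : 'Hom(V, W)) la (X : tensor_rep A V) :
  equivariant g -> X \in hwspace (tensor_rep A V) la ->
  of_crd (fun S => g (crd S X)) \in hwspace (tensor_rep A W) la.
Proof.
move=> /equivariantP g_gE /hwspaceP[up wt]; set G := of_crd _.
have E i j S : crd S (gE (tensor_rep A W) i j G) = g (crd S (gE (tensor_rep A V) i j X)).
  rewrite !crd_gE !of_crdK linearD /= g_gE; congr (_ + _).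
  by case: ifP; rewrite ?linear0 // linearZ.
apply/hwspaceP; split=> [i j ij | i]; apply: crd_inj => S; rewrite E.
  by rewrite up // !linear0.
by rewrite wt !linearZ /= of_crdK.
Qed.

Definition del (la : 'I_n -> int) S i : int := la i - ((i \in S) : nat)%:Z.

Lemma hw_ortho W B (HB : @contravariant_form F n W B) mu nu (x y : W) :
  (exists i, mu i != nu i) -> x \in hwspace W mu -> y \in hwspace W nu -> B x y = 0.
Proof.
case=> i mu_nu /hwspaceP[_ wtx] /hwspaceP[_ wty].
have : (mu i)%:~R * B x y = (nu i)%:~R * B x y.
  by rewrite -(cformZ HB) -wtx (cform_gE HB) wty (cformZr HB) rmorph_int.
move/eqP; rewrite -subr_eq0 -mulrBl -rmorphB mulf_eq0 intr_eq0 subr_eq0.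
by rewrite (negPf mu_nu) /= => /eqP.
Qed.

Section Step.
Variables (W : glrep F n) (B : W -> W -> F) (HB : contravariant_form B) (la : 'I_n -> int).
Local Notation AW := (tensor_rep A W).
Local Notation H S := (hwspace W (del la S)).

(* Among the components of a highest weight vector [X], ordered by the sum of
   the elements of [S], the last nonzero one is a highest weight vector. *)
Lemma hw_leading (X : AW) : X \in hwspace AW la ->
  (forall S, crd S X \in H S -> crd S X = 0) -> X = 0.
Proof.
move=> /hwspaceP[up wt] XH; apply: crd_inj => S; rewrite linear0.
pose sz T := (\sum_(t in T) t)%N.
have [d] := ubnP (sz setT - sz S)%N; elim: d S => // d IHd S; rewrite ltnS => dS.
apply: XH; apply/hwspaceP; split=> [i j ij | i].
  have := congr1 (crd S) (up i j ij); rewrite crd_gE linear0.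
  case: ifP => [/andP[iS] | _ ]; last by rewrite addr0.
  (* Replacing [i] by the larger [j] increases the sum of the elements, so this component is already
     known to vanish. *)
  rewrite !inE => jS; rewrite (IHd (j |: S :\ i)) ?scaler0 ?addr0 //.
  have ji : j != i by rewrite -val_eqE gtn_eqF.
  rewrite ji /= in jS.
  have szS : sz S = (i + sz (S :\ i))%N by rewrite /sz (big_setD1 i).
  have szT : sz (j |: S :\ i) = (j + sz (S :\ i))%N by rewrite /sz big_setU1 // !inE negb_and jS orbT.
  have le T : (sz T <= sz setT)%N.
    by rewrite /sz [X in (_ <= X)%N](big_setID T) /= setTI leq_addr.
  by have := le (j |: S :\ i); rewrite szT; move: dS; rewrite szS; lia.
have := congr1 (crd S) (wt i); rewrite crd_gE linearZ /= setD11 andbT /del.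
case: (boolP (i \in S)) => iS; last by rewrite addr0 subr0.
rewrite setD1K // ksignD // ltnn mul1r ksign_sq scale1r => /eqP.
by rewrite eq_sym -subr_eq => /eqP <-; rewrite rmorphB /= scalerBl scale1r.
Qed.

Hypothesis dom : forall i j, (i <= j)%N -> la j <= la i.
(** The weights la - 1_S that occur in [W] can then be realized by [hwvec] in a tensor power. *)
Hypothesis nneg : forall S, H S != 0%VS -> forall i, 0 <= del la S i.

(** In a tensor power of the exterior algebra let [u] and [v] have weights la and la - 1_S, and let
    [g] send [v] to [h] as in [hw_extension]. Applying [g] to all components of [coaction u] gives a
    vector whose component at T pairs with y in H T as a scalar times B(h, y). For T = S the scalar
    is nonzero; for other T the weights of h and y differ. *)
Lemma hw_lift S (h : W) : h \in H S -> exists2 X, X \in hwspace AW la &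
  orthproj HB (H S) (crd S X) = h /\
  forall T, T != S -> orthproj HB (H T) (crd T X) = 0.
Proof.
move=> hH; have [->|h_neq0] := eqVneq h 0.
  by exists 0; rewrite ?mem0v // linear0; split=> [|T _]; rewrite !linear0.
have HS0 : H S != 0%VS by apply: contraNneq h_neq0 => H0; rewrite -memv0 -H0.
have mu_ge0 := nneg HS0.
have mu_dom i j : (i <= j)%N -> del la S j <= del la S i.
  rewrite leq_eqVlt => /predU1P[/val_inj -> // | ij].
  rewrite leNgt; apply/negP => lt_ij; move/eqP: HS0; apply.
  by apply: (hw_dominant HB); exists i, j.
pose lan i := `|la i|%N; pose mun i := `|del la S i|%N.
have muE i : (mun i)%:Z = del la S i by rewrite /mun gez0_abs.
have la_ge0 i : 0 <= la i.
  by apply: le_trans (mu_ge0 i) _; rewrite /del lerBlDr lerDl.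
have laE i : (lan i)%:Z = la i by rewrite /lan gez0_abs.
have lan_mun i : lan i = (mun i + (i \in S))%N.
  by apply/eqP; rewrite -eqz_nat PoszD muE laE /del subrK.
pose l := (\max_i lan i)%N.
have lan_le i : (lan i <= l)%N by exact: (leq_bigmax_cond (F := lan)).
have lan_dom i j : (i <= j)%N -> (lan j <= lan i)%N.
  by move/dom; rewrite -!laE lez_nat.
have mun_dom i j : (i <= j)%N -> (mun j <= mun i)%N.
  by move/mu_dom; rewrite -!muE lez_nat.
have mun_le i : (mun i <= l)%N by apply: leq_trans (lan_le i); rewrite lan_mun leq_addr.
pose V := tensor_power A l; pose BV := power_form (F := F) (n := n) (l := l).
have HV : contravariant_form BV := power_formP F n l.
pose v : V := hwvec F l mun; pose u : V := hwvec F l lan.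
have vH : v \in hwspace V (del la S).
  by have := hwvec_hw F mun_dom mun_le; rewrite (eq_hwspace _ muE).
have uH : u \in hwspace V la.
  by have := hwvec_hw F lan_dom lan_le; rewrite (eq_hwspace _ laE).
have v_neq0 : v != 0.
  apply/negP => /eqP v0; have := anns_hwvec F (s := [::]) isT mun_le (fun i => esym (addn0 (mun i))).
  by rewrite [anns _ _]/= -/v -/BV v0 (cform0 HV) eqxx.
have pair_neq0 : BV (annS S u) v != 0.
  apply: anns_hwvec => //; first exact: enum_uniq.
  by move=> i; rewrite mem_enum lan_mun.
have [g g_eq gE] := hw_extension HV HB v_neq0 vH hH.
pose X := of_crd (fun T => g (crd T (coaction u))).
have XH : X \in hwspace AW la by exact/tensor_map_hw/coaction_hw.
pose c := BV (annS S u) v / BV v v.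
have c_neq0 : c != 0 by rewrite mulf_neq0 ?invr_eq0 ?(cform_eq0 HV).
(* The lowered part of [g (annS T u)] is orthogonal to highest weight vectors. *)
have XE T y : y \in H T -> B (crd T X) y = BV (annS T u) v / BV v v * B h y.
  move=> yH; rewrite !of_crdK; have [t tL ->] := gE (annS T u).
  rewrite (cformD HB) (cformZ HB) [X in _ + X](cform_lowered HB _ tL) ?addr0 //.
  by case/hwspaceP: yH.
exists (c^-1 *: X); first by rewrite rpredZ.
split=> [|T TS]; rewrite !linearZ /=.
  apply/eqP; rewrite -(inj_eq (scalerI c_neq0)) scalerA divff // scale1r -subr_eq0.
  set y := _ - _; have yH : y \in H S by rewrite rpredB ?rpredZ ?orthproj_mem.
  rewrite -(cform_eq0 HB) {1}/y (cformD HB) -scaleN1r (cformZ HB) (cformZ HB).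
  by rewrite (orthprojE HB) // XE // -/c mulN1r subrr.
set y := orthproj _ _ _; have yH : y \in H T by exact: orthproj_mem.
suff /eqP -> : y == 0 by rewrite scaler0.
rewrite -(cform_eq0 HB) {1}/y (orthprojE HB) // XE // (hw_ortho HB _ hH yH) ?mulr0 //.
have /existsP[i iST] : [exists i, (i \in S) != (i \in T)].
  rewrite -negb_forall; apply: contra TS => /forallP ST.
  by apply/eqP/setP => i; have /eqP -> := ST i.
exists i; apply: contra iST; rewrite /del; case: (i \in S); case: (i \in T); lia.
Qed.

(** The coordinates of [X] are the projections of its components to the spaces [H S]: [hw_leading]
    makes them jointly injective, and [hw_lift] prescribes them one by one. *)
Lemma hw_tensor_dim : \dim (hwspace AW la) = (\sum_S \dim (H S))%N.
Proof.
apply: (dimv_joint_coordinates (f := fun S => (orthproj HB (H S) \o crd S)%VF)).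
- by move=> S X _; rewrite comp_lfunE orthproj_mem.
- move=> X XH X0; apply: hw_leading XH _ => S XS.
  by have := X0 S; rewrite comp_lfunE orthproj_id.
- move=> S h /hw_lift[X XH [XS XT]]; exists X => //; split=> [|T /XT].
    by rewrite comp_lfunE.
  by rewrite comp_lfunE.
Qed.

End Step.

End TensorStep.

(** * Determinants of binomial coefficients *)

Lemma binz_lt0 a b : b < 0 -> binz a b = 0%N.
Proof. by case: b. Qed.

Lemma binzS a b : binz a.+1 b = (binz a b + binz a (b - 1))%N.
Proof.
case: b => [[|m]|m]; try by rewrite (@binz_lt0 _ (_ - _)) //= !bin0.
by rewrite (_ : m.+1%:Z - 1 = m%:Z) /= ?binS //; lia.
Qed.

Lemma binz_subn a m r : binz a (m%:Z - r%:Z) = (if (r <= m)%N then 'C(a, m - r) else 0%N).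
Proof.
case: leqP => [rm | mr]; first by rewrite subzn.
by rewrite binz_lt0 // subr_lt0 ltz_nat.
Qed.

Lemma binz_Vandermonde n k i m : (i < n)%N ->
  (\sum_(r < n) 'C(i, r) * binz k (m%:Z - r%:Z))%N = 'C(k + i, m).
Proof.
move=> i_n; rewrite (addnC k) -binomial.Vandermonde.
pose f r := ('C(i, r) * binz k (m%:Z - r%:Z))%N.
(* Both sums are parts of this one: terms with r >= n vanish because i < n, those with r > m because
   the lower index is negative. *)
transitivity (\sum_(r < n + m.+1) f r)%N.
  rewrite big_split_ord /= [X in (_ + X)%N]big1 ?addn0 // => r _.
  by rewrite /f bin_small // ltn_addr.
rewrite addnC big_split_ord /= [X in (_ + X)%N]big1 ?addn0 => [|r _].
  by apply: eq_bigr => r _; rewrite /f binz_subn -ltnS ltn_ord.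
by rewrite /f binz_subn ifN ?muln0 // -ltnNge ltn_addr.
Qed.

Lemma det_col_eq0 (R : comRingType) n (M : 'M[R]_n) j : (forall i, M i j = 0) -> \det M = 0.
Proof. by move=> Mj; rewrite (expand_det_col M j) big1 // => i _; rewrite Mj mul0r. Qed.

Lemma det_sum_rows (R : comRingType) n (I : finType) (a : I -> 'I_n -> 'I_n -> R) :
  \det (\matrix_(i, j) \sum_b a b i j) =
  \sum_(f : {ffun 'I_n -> I}) \det (\matrix_(i, j) a (f i) i j).
Proof.
rewrite /determinant exchange_big; apply: eq_bigr => s _.
rewrite -mulr_sumr; congr (_ * _).
under eq_bigr do rewrite mxE; rewrite bigA_distr_bigA; apply: eq_bigr => f _.
by apply: eq_bigr => i _; rewrite mxE.
Qed.

Section HighestWeightDeterminant.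
Variable n : nat.
Implicit Types (la mu : 'I_n -> int) (S : {set 'I_n}).

(** For a partition [la] this is the dual Jacobi-Trudi determinant, up to reversing rows and columns
    and transposing: the Schur function of the conjugate partition at [k] ones. *)
Definition hwdet k la : int :=
  \det (\matrix_(i < n, j < n) (binz k (la (rev_ord j) + j%:Z - i%:Z))%:Z).

(** Pascal's rule splits every column in two; [S] records, through [rev_ord], the columns in which
    the lower index drops. *)
Lemma hwdetS k la : hwdet k.+1 la = \sum_S hwdet k (del la S).
Proof.
pose a (b : bool) (j i : 'I_n) : int := (binz k (la (rev_ord j) - (b : nat)%:Z + j%:Z - i%:Z))%:Z.
transitivity (\det (\matrix_(j, i) \sum_b a b j i)).
  rewrite -[RHS]det_tr; congr (\det _); apply/matrixP => i j.
  rewrite !mxE big_bool /a binzS /= addnC PoszD subr0; congr (_%:Z + _).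
  by congr (binz _ _); ring.
rewrite det_sum_rows (reindex (fun S => [ffun j => rev_ord j \in S])) /=; last first.
  exists (fun f : {ffun 'I_n -> bool} => [set i | f (rev_ord i)]) => [S _ | f _].
    by apply/setP => i; rewrite inE ffunE rev_ordK.
  by apply/ffunP => i; rewrite ffunE inE rev_ordK.
apply: eq_bigr => S _; rewrite /hwdet -det_tr; congr (\det _).
by apply/matrixP => i j; rewrite !mxE ffunE.
Qed.

(** A failure of dominance is located at neighbouring indices, where it makes two columns equal. *)
Lemma dominantVadjacent mu : (forall i j : 'I_n, (i <= j)%N -> mu j <= mu i) \/
  (exists i j : 'I_n, j = i.+1 :> nat /\ mu i < mu j).
Proof.
case: (pselect (exists i j : 'I_n, j = i.+1 :> nat /\ mu i < mu j)) => [|noadj].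
  by right.
left=> i; suff H d (j : 'I_n) : j = (i + d)%N :> nat -> mu j <= mu i.
  by move=> j ij; apply: (H (j - i)%N); rewrite subnKC.
elim: d j => [|d IHd] j jE; first by rewrite (_ : j = i) //; apply: val_inj; rewrite /= jE addn0.
have idn : (i + d < n)%N by apply: leq_trans (ltn_ord j); rewrite jE addnS.
apply: le_trans (IHd (Ordinal idn) erefl); rewrite leNgt; apply/negP => lt.
by apply: noadj; exists (Ordinal idn), j; rewrite jE addnS.
Qed.

(** Subtracting 1_S from a dominant weight can only break dominance by one, and then the columns of
    [i] and [j] coincide. *)
Lemma hwdet_adjacent k la S (i j : 'I_n) :
  (forall p q : 'I_n, (p <= q)%N -> la q <= la p) ->
  j = i.+1 :> nat -> del la S i < del la S j -> hwdet k (del la S) = 0.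
Proof.
move=> dom ji lt; rewrite /hwdet -det_tr.
have ij : (i <= j)%N by rewrite ji.
have E : del la S i + 1 = del la S j.
  by have := dom i j ij; move: lt; rewrite /del; case: (i \in S); case: (j \in S); lia.
apply: (@determinant_alternate _ _ _ (rev_ord i) (rev_ord j)).
  by rewrite (inj_eq rev_ord_inj) -val_eqE /= ji ltn_eqF.
move=> r; rewrite !mxE !rev_ordK -E; congr (binz _ _)%:Z; rewrite /= ji.
by have := ltn_ord j; rewrite ji; lia.
Qed.

(** The last entry of [mu] is negative too, so column 0 has only negative lower indices. *)
Lemma hwdet_lt0 k mu i : (forall i j : 'I_n, (i <= j)%N -> mu j <= mu i) -> mu i < 0 -> hwdet k mu = 0.
Proof.
move=> dom mui; have n_gt0 : (0 < n)%N by apply: leq_ltn_trans (ltn_ord i).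
apply: (det_col_eq0 (j := Ordinal n_gt0)) => r; rewrite mxE binz_lt0 //.
have := dom i (rev_ord (Ordinal n_gt0)); rewrite /= -ltnS subn1 prednK // => /(_ (ltn_ord i)).
lia.
Qed.

(** The matrix is the identity for mu = 0. If some entry of [mu] is positive, so is the first, and
    the last column consists of binomials of 0 with positive lower index. *)
Lemma hwdet0 mu : (forall i j : 'I_n, (i <= j)%N -> mu j <= mu i) ->
  hwdet 0 mu = [forall i, mu i == 0]%:Z.
Proof.
move=> dom; case: (boolP [forall i, mu i == 0]) => [/forallP mu0 | ].
  transitivity (\det (1%:M : 'M[int]_n)); last exact: det1.
  congr (\det _); apply/matrixP => i j.
  rewrite !mxE (eqP (mu0 _)) add0r binz_subn -val_eqE /=.
  by case: ltngtP => // ij; rewrite ?ij ?subnn // bin_small // subn_gt0.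
rewrite negb_forall => /existsP[p]; rewrite neq_lt => /orP[/(hwdet_lt0 _ dom)-> // | mu_p].
have n_gt0 : (0 < n)%N by apply: leq_ltn_trans (ltn_ord p).
apply: (det_col_eq0 (j := rev_ord (Ordinal n_gt0))) => r; rewrite mxE rev_ordK /=.
have mu0 := lt_le_trans mu_p (dom (Ordinal n_gt0) p (leq0n _)).
have rn := ltn_ord r; move: mu0; set x := mu _ => mu0.
case E : (x + _ - _) => [[|m]|m] //=.
by move: E; lia.
Qed.

Lemma hwdet_binomial k (la : 'I_n -> nat) :
  \det (\matrix_(i < n, j < n) 'C(k + i, j + la (rev_ord j))%:Z) =
  hwdet k (fun i => (la i)%:Z).
Proof.
pose L : 'M[int]_n := \matrix_(i, r) 'C(i, r)%:Z.
have detL : \det L = 1.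
  rewrite det_trig; first by rewrite big1 // => i _; rewrite mxE binn.
  by apply/is_trig_mxP => i j ij; rewrite mxE bin_small.
rewrite -[RHS]mul1r -detL -det_mulmx; congr (\det _); apply/matrixP => i j.
rewrite !mxE -(binz_Vandermonde k _ (ltn_ord i)) -[LHS]natz natr_sum.
apply: eq_bigr => r _; rewrite !mxE natz PoszM; congr (_ * (binz _ _)%:Z).
by rewrite PoszD; ring.
Qed.

(** For j + m > k + i the lower index on the left is negative, and both sides are 0. *)
Lemma binz_compl k i j m : binz (k + i) ((k + i)%:Z - j%:Z - m%:Z) = 'C(k + i, j + m).
Proof.
rewrite -addrA -opprD -PoszD binz_subn.
by case: leqP => [/bin_sub // | /bin_small ->].
Qed.

End HighestWeightDeterminant.

(** * Highest weight spaces of the tensor powers, and the multiplicity formula *)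

Lemma hwspace_trivial_dim (F : numClosedFieldType) n (mu : 'I_n -> int) :
  \dim (hwspace (trivial_rep F n) mu) = [forall i, mu i == 0].
Proof.
case: (boolP [forall i, mu i == 0]) => [/forallP mu0 | ].
  rewrite (_ : hwspace _ _ = fullv); first exact: (dimvf (line F)).
  apply/vspaceP => x; rewrite memvf; apply/hwspaceP.
  by split=> [i j _ | i]; rewrite gE_trivial // (eqP (mu0 i)) scale0r.
rewrite negb_forall => /existsP[p mu_p].
apply/eqP; rewrite dimv_eq0 -subv0; apply/subvP => x /hwspaceP[_ /(_ p)].
rewrite gE_trivial memv0 => /esym/eqP.
by rewrite scaler_eq0 intr_eq0 (negPf mu_p).
Qed.

(** Both sides obey the same recursion in [k]. For nondominant la - 1_S, the determinant has equal
    columns and the highest weight space is zero by positivity. *)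
Lemma hwspace_power_dim (F : numClosedFieldType) n k (la : 'I_n -> int) :
  (forall i j : 'I_n, (i <= j)%N -> la j <= la i) ->
  (\dim (hwspace (tensor_power (exterior_rep F n) k) la))%:Z = hwdet k la.
Proof.
elim: k la => [|k IHk] la dom; first by rewrite hwspace_trivial_dim hwdet0.
have HB := power_formP F n k.
rewrite (hw_tensor_dim HB dom) => [|S HS i].
  rewrite hwdetS -[LHS]natz natr_sum; apply: eq_bigr => S _; rewrite natz.
  case: (dominantVadjacent (del la S)) => [/IHk // | [i [j [ji lt]]]].
  rewrite (hwdet_adjacent k dom ji lt) (hw_dominant HB) ?dimv0 //.
  by exists i, j; rewrite ji.
(* The nonnegativity hypothesis of [hw_tensor_dim]: by induction, a dominant weight with a negative
   entry has a zero determinant, hence no highest weight vectors. *)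
case: (dominantVadjacent (del la S)) => [domS | [p [q [pq lt]]]]; last first.
  by case/eqP: HS; apply: (hw_dominant HB); exists p, q; rewrite pq.
rewrite leNgt; apply/negP => del_lt0; case/negP: HS.
by rewrite -dimv_eq0 -eqz_nat IHk // (hwdet_lt0 _ domS del_lt0).
Qed.

(* With indices starting at 0, lambda_(n-j) is la (n-1-j) = la (rev_ord j). *)
Theorem proposition4p1 (R : realType) (n k : nat)
    (n_gt0 : (0 < n)%N) (k_gt0 : (0 < k)%N)
    (la : 'I_n -> nat)
    (la_partition : forall i j : 'I_n, (i <= j)%N -> (la j <= la i)%N)
    (L : glrep R[i] n) (L_la : is_irrep_of_highest_weight L la) :
  exists m : nat,
    [/\ has_multiplicity L (tensor_power (exterior_rep R[i] n) k) m,
        m%:Z = \det (\matrix_(i < n, j < n)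
          (binz (k + i) ((k + i)%:Z - j%:Z - (la (rev_ord j))%:Z))%:Z) &
        \det (\matrix_(i < n, j < n)
          (binz (k + i) ((k + i)%:Z - j%:Z - (la (rev_ord j))%:Z))%:Z)
        = \det (\matrix_(i < n, j < n)
            'C(k + i, j + la (rev_ord j))%:Z)].
Proof.
have detE : \det (\matrix_(i < n, j < n)
      (binz (k + i) ((k + i)%:Z - j%:Z - (la (rev_ord j))%:Z))%:Z)
    = \det (\matrix_(i < n, j < n) 'C(k + i, j + la (rev_ord j))%:Z) :> int.
  by congr (\det _); apply/matrixP => i j; rewrite !mxE binz_compl.
exists (\dim (hwspace (tensor_power (exterior_rep R[i] n) k) (fun i => (la i)%:Z))).
split=> //; first exact: (has_multiplicity_hwspace (power_formP _ n k) L_la).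
rewrite detE hwdet_binomial; apply: hwspace_power_dim => i j ij.
by rewrite lez_nat la_partition.
Qed.
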